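(* Let $n\ge3$ be odd, $\Gamma\subset\mathbb R^n$ a lattice and $\Gamma^*=\{\gamma\in\mathbb R^n:\langle\gamma,\mu\rangle\in\mathbb Z\ \forall\mu\in\Gamma\}$ its dual lattice, and let $M=\mathbb R^n/\Gamma$ be the flat torus with the orientation induced from $\mathbb R^n$. Then a number $\lambda\ne0$ is an eigenvalue of $\operatorname{curl}$ on $M$ if and only if there exists $\mu\in\Gamma^*$ with $|\lambda|=2\pi|\mu|$, and in that case $$m(\operatorname{curl},\lambda)=\frac12\binom{n-1}{\frac{n-1}{2}}\cdot\#\Big\{\mu\in\Gamma^*:|\mu|=\frac{|\lambda|}{2\pi}\Big\}.$$
   Context: For $M$ oriented of odd dimension $n$ with exterior differential $d$ and Hodge star $\ast$, the curl operator on complex-valued $\frac{n-1}{2}$-forms is $\operatorname{curl}=i\ast d$ if $n\equiv1\pmod 4$ and $\operatorname{curl}=\ast d$ if $n\equiv 3\pmod 4$; $m(\operatorname{curl},\lambda)$ is the dimension of its eigenspace for $\lambda$. *)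

(* Defs.v *)
From Stdlib Require Import Reals Lra Lia List Sorted Bool Arith.
Import ListNotations.
Open Scope R_scope.

(* Points of R^n are modeled as [nat -> R]; only coordinates [i < n] matter. *)
Definition Pt := nat -> R.

Definition Cx := (R * R)%type.
Definition cadd (z w : Cx) : Cx := (fst z + fst w, snd z + snd w).
Definition cmul (z w : Cx) : Cx :=
  (fst z * fst w - snd z * snd w, fst z * snd w + snd z * fst w).
Definition cscal (r : R) (z : Cx) : Cx := (r * fst z, r * snd z).
Definition cI (z : Cx) : Cx := (- snd z, fst z).
Definition c0 : Cx := (0, 0).

Fixpoint rsum (n : nat) (f : nat -> R) : R :=
  match n with O => 0 | S m => rsum m f + f m end.

Definition vnorm (n : nat) (v : Pt) : R := sqrt (rsum n (fun i => v i * v i)).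
Definition dot (n : nat) (u v : Pt) : R := rsum n (fun i => u i * v i).

(* Lattice with basis vectors b 0, ..., b (n-1), where b j i is the i-th
   coordinate of the j-th basis vector. *)
Definition basis_indep (n : nat) (b : nat -> Pt) : Prop :=
  forall c : nat -> R,
    (forall i, (i < n)%nat -> rsum n (fun j => c j * b j i) = 0) ->
    forall j, (j < n)%nat -> c j = 0.

Definition lattice_mem (n : nat) (b : nat -> Pt) (v : Pt) : Prop :=
  exists m : nat -> Z, forall i, (i < n)%nat -> v i = rsum n (fun j => IZR (m j) * b j i).

Definition dual_mem (n : nat) (b : nat -> Pt) (mu : Pt) : Prop :=
  forall v, lattice_mem n b v -> exists z : Z, dot n mu v = IZR z.

Definition card_vecs (n : nat) (P : Pt -> Prop) (N : nat) : Prop :=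
  exists l : list Pt, length l = N /\ Forall P l /\
    (forall a c, (a < c)%nat -> (c < N)%nat ->
       exists i, (i < n)%nat /\ nth a l (fun _ => 0) i <> nth c l (fun _ => 0) i) /\
    (forall mu, P mu -> exists a, (a < N)%nat /\
       forall i, (i < n)%nat -> nth a l (fun _ => 0) i = mu i).

Definition shift (x : Pt) (i : nat) (t : R) : Pt :=
  fun j => if Nat.eqb j i then x j + t else x j.

Definition pd (i : nat) (f g : Pt -> R) : Prop :=
  forall x, derivable_pt_lim (fun t => f (shift x i t)) 0 (g x).

Fixpoint iter_pd (f : Pt -> R) (ds : list nat) (g : Pt -> R) : Prop :=
  match ds with
  | [] => forall x, g x = f x
  | i :: ds' => exists h, iter_pd f ds' h /\ pd i h g
  end.

Definition cont_n (n : nat) (g : Pt -> R) : Prop :=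
  forall x eps, 0 < eps -> exists delta, 0 < delta /\
    forall y, (forall i, (i < n)%nat -> Rabs (y i - x i) < delta) ->
      Rabs (g y - g x) < eps.

Definition smooth_n (n : nat) (f : Pt -> R) : Prop :=
  forall ds, Forall (fun i => (i < n)%nat) ds ->
    exists g, iter_pd f ds g /\ cont_n n g.

Definition valid_idx (n k : nat) (I : list nat) : Prop :=
  length I = k /\ Sorted lt I /\ Forall (fun i => (i < n)%nat) I.

(* A complex-valued form: components on increasing multi-indices
   (omega = sum_I omega_I dx^I). *)
Definition Form := list nat -> Pt -> Cx.

Definition compl (n : nat) (I : list nat) : list nat :=
  filter (fun j => negb (existsb (Nat.eqb j) I)) (seq 0 n).

Fixpoint remove_nth (a : nat) (l : list nat) : list nat :=
  match a, l with
  | _, [] => []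
  | O, _ :: t => t
  | S a', h :: t => h :: remove_nth a' t
  end.

(* number of inversions of the concatenation A ++ B (A, B increasing) *)
Definition ninv (A B : list nat) : nat :=
  fold_right plus O (map (fun a => length (filter (fun c => Nat.ltb c a) B)) A).

Definition sgn (m : nat) : R := if Nat.even m then 1 else -1.

(* Given the first partial derivatives P i I x of the components omega_I
   (direction i), the exterior derivative:
   (d omega)_J = sum_a (-1)^a d_{j_a} omega_{J without j_a} *)
Definition dform_at (P : nat -> list nat -> Pt -> Cx) (J : list nat) (x : Pt) : Cx :=
  fold_right cadd c0
    (map (fun a => cscal (sgn a) (P (nth a J O) (remove_nth a J) x))
         (seq 0 (length J))).

(* Hodge star for the standard metric/orientation of R^n:
   *(dx^J) = sign(J, J^c) dx^{J^c}, hence ( *eta)_I = sign(I^c, I) eta_{I^c}. *)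
Definition curl_at (n : nat) (P : nat -> list nat -> Pt -> Cx) (I : list nat) (x : Pt) : Cx :=
  let v := cscal (sgn (ninv (compl n I) I)) (dform_at P (compl n I) x) in
  if Nat.eqb (Nat.modulo n 4) 1 then cI v else v.

(* admissible = smooth Gamma-periodic complex (n-1)/2-form on M = R^n / Gamma *)
Definition admissible (n : nat) (b : nat -> Pt) (w : Form) : Prop :=
  let k := Nat.div (n - 1) 2 in
  (forall I x, ~ valid_idx n k I -> w I x = c0) /\
  (forall I, valid_idx n k I ->
     smooth_n n (fun x => fst (w I x)) /\ smooth_n n (fun x => snd (w I x)) /\
     (forall x y, (forall i, (i < n)%nat -> x i = y i) -> w I x = w I y) /\
     (forall v x, lattice_mem n b v -> w I (fun i => x i + v i) = w I x)).

Definition curl_eq (n : nat) (w : Form) (lam : R) : Prop :=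
  let k := Nat.div (n - 1) 2 in
  exists P : nat -> list nat -> Pt -> Cx,
    (forall i I, (i < n)%nat -> valid_idx n k I ->
       pd i (fun x => fst (w I x)) (fun x => fst (P i I x)) /\
       pd i (fun x => snd (w I x)) (fun x => snd (P i I x))) /\
    (forall I x, valid_idx n k I -> curl_at n P I x = cscal lam (w I x)).

Definition eigensp (n : nat) (b : nat -> Pt) (lam : R) (w : Form) : Prop :=
  admissible n b w /\ curl_eq n w lam.

Definition nonzero_form (w : Form) : Prop := exists I x, w I x <> c0.

Definition is_eigenvalue (n : nat) (b : nat -> Pt) (lam : R) : Prop :=
  exists w, eigensp n b lam w /\ nonzero_form w.

Definition lincomb (cs : list Cx) (ws : list Form) : Form :=
  fun I x => fold_right cadd c0 (map (fun p => cmul (fst p) (snd p I x)) (combine cs ws)).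

Definition cdim (E : Form -> Prop) (d : nat) : Prop :=
  exists ws : list Form, length ws = d /\ Forall E ws /\
    (forall cs, length cs = d -> (forall I x, lincomb cs ws I x = c0) -> Forall (fun c => c = c0) cs) /\
    (forall w, E w -> exists cs, length cs = d /\ forall I x, w I x = lincomb cs ws I x).

(* Main.v *)
(** Decompose an eigenform [w] into its Fourier modes.  Averaging along each basis vector
    of the lattice against a character commutes with partial derivatives and returns
    [a(mu) exp(2 i pi <mu, x>)] with [T_mu a(mu) = lam a(mu)], where [T_mu] is the symbol
    of the curl, a multiple of [star o (mu /\ -)].  Fejer's theorem, applied in one direction
    at a time, shows that a periodic continuous function without Fourier modes vanishes.

    On k-forms, n = 2k + 1, the Clifford relations give [T^3 = (2 pi |mu|)^2 T].  Hence
    [lam <> 0] is an eigenvalue of [T_mu] only if [|lam| = 2 pi |mu|], so finitely many [mu]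
    contribute, and the eigenprojection is [(T^2 + lam T) / (2 lam^2)].  As [tr T = 0] and
    [tr T^2 = lam^2 binom(n-1, k)], its rank is [binom(n-1, k) / 2]. *)

From Stdlib Require Import Reals Lra Lia ZArith List Sorted.
From Stdlib Require Import FunctionalExtensionality Classical IndefiniteDescription.
From Coquelicot Require Coquelicot.
From mathcomp Require all_boot all_algebra complex Rstruct ring zify.
Require Import Defs.
Open Scope R_scope.

(** The lattice need not be cubic, and no change of coordinates to a standard torus is made:
    averaging along an arbitrary vector commutes with every coordinate derivative, so the characters
    follow the lattice basis while the curl stays in the coordinates of R^n. As an eigenform is a
    finite sum of modes, no convergence of Fourier series is involved.

    Neither an inner product nor self-adjointness is used: the symbol is diagonalised by its cubic
    identity, whose roots lam, 0, -lam are distinct. The factor i in the curl for n = 1 mod 4 makes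
    the square of the symbol a positive multiple of contraction after wedge in both parities of k,
    which is why the roots are real. The trace vanishes because the complement of a k-subset is
    disjoint from it; this balances lam against -lam and yields the factor 1/2. The trace of the
    square counts, for each index j, the k-subsets that avoid j, whence the n - 1 in the binomial
    coefficient. *)

Module FourierLine.
Import Coquelicot Defs.

(** * Continuous functions of one variable and their integrals over [0, 1] *)

Definition cont1 (g : R -> R) : Prop := forall s, continuous g s.

Lemma cont1_ex_RInt g a b : cont1 g -> ex_RInt g a b.
Proof. intros H; apply (ex_RInt_continuous (V := R_CompleteNormedModule)); intros z _; apply H. Qed.

Lemma cont1_plus f g : cont1 f -> cont1 g -> cont1 (fun s => f s + g s).
Proof. intros Hf Hg s; exact (continuous_plus f g s (Hf s) (Hg s)). Qed.

Lemma cont1_minus f g : cont1 f -> cont1 g -> cont1 (fun s => f s - g s).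
Proof. intros Hf Hg s; exact (continuous_minus f g s (Hf s) (Hg s)). Qed.

Lemma cont1_opp f : cont1 f -> cont1 (fun s => - f s).
Proof. intros Hf s; exact (continuous_opp f s (Hf s)). Qed.

Lemma cont1_mult f g : cont1 f -> cont1 g -> cont1 (fun s => f s * g s).
Proof. intros Hf Hg s; exact (continuous_mult f g s (Hf s) (Hg s)). Qed.

Lemma cont1_const c : cont1 (fun _ => c).
Proof. intros s; apply continuous_const. Qed.

Lemma cont1_id : cont1 (fun s => s).
Proof. intros s; apply continuous_id. Qed.

Lemma cont1_cos f : cont1 f -> cont1 (fun s => cos (f s)).
Proof. intros Hf s; apply continuous_cos_comp, Hf. Qed.

Lemma cont1_sin f : cont1 f -> cont1 (fun s => sin (f s)).
Proof. intros Hf s; apply continuous_sin_comp, Hf. Qed.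

Lemma cont1_Rabs f : cont1 f -> cont1 (fun s => Rabs (f s)).
Proof. intros Hf s; apply continuous_Rabs_comp, Hf. Qed.

Lemma cont1_rsum n (f : nat -> R -> R) :
  (forall j, cont1 (f j)) -> cont1 (fun s => rsum n (fun j => f j s)).
Proof.
  intros H; induction n as [|n IH]; simpl; [apply cont1_const|].
  apply cont1_plus; auto.
Qed.

Ltac cont1 :=
  lazymatch goal with
  | |- cont1 ?h =>
    first [ assumption
    | let h' := eval cbv beta in h in
      lazymatch h' with
      | (fun s => @?p1 s + @?p2 s) => apply (cont1_plus p1 p2); cont1
      | (fun s => @?p1 s - @?p2 s) => apply (cont1_minus p1 p2); cont1
      | (fun s => @?p1 s * @?p2 s) => apply (cont1_mult p1 p2); cont1
      | (fun s => - @?p1 s) => apply (cont1_opp p1); cont1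
      | (fun s => cos (@?p1 s)) => apply (cont1_cos p1); cont1
      | (fun s => sin (@?p1 s)) => apply (cont1_sin p1); cont1
      | (fun s => Rabs (@?p1 s)) => apply (cont1_Rabs p1); cont1
      | (fun s => rsum ?n (@?p1 s)) => apply (cont1_rsum n (fun j s => p1 s j)); intro; cont1
      | (fun _ => ?c) => apply (cont1_const c)
      | (fun s => s) => apply cont1_id
      end ]
  end.

Definition int1 (g : R -> R) : R := RInt g 0 1.

Lemma int1_ext f g : (forall s, f s = g s) -> int1 f = int1 g.
Proof. intros H; apply RInt_ext; intros; apply H. Qed.

Lemma int1_plus f g : cont1 f -> cont1 g -> int1 (fun s => f s + g s) = int1 f + int1 g.
Proof. intros Hf Hg; exact (RInt_plus f g 0 1 (cont1_ex_RInt _ _ _ Hf) (cont1_ex_RInt _ _ _ Hg)). Qed.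

Lemma int1_minus f g : cont1 f -> cont1 g -> int1 (fun s => f s - g s) = int1 f - int1 g.
Proof. intros Hf Hg; exact (RInt_minus f g 0 1 (cont1_ex_RInt _ _ _ Hf) (cont1_ex_RInt _ _ _ Hg)). Qed.

Lemma int1_scal c f : cont1 f -> int1 (fun s => c * f s) = c * int1 f.
Proof. intros Hf; exact (RInt_scal f 0 1 c (cont1_ex_RInt _ _ _ Hf)). Qed.

Lemma int1_const c : int1 (fun _ => c) = c.
Proof. unfold int1; rewrite RInt_const; unfold scal; simpl; unfold mult; simpl; ring. Qed.

Lemma int1_le f g : cont1 f -> cont1 g -> (forall s, 0 <= s <= 1 -> f s <= g s) -> int1 f <= int1 g.
Proof.
  intros Hf Hg H; apply RInt_le; [lra|now apply cont1_ex_RInt..|].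
  intros s Hs; apply H; lra.
Qed.

Lemma int1_rsum n (f : nat -> R -> R) : (forall j, cont1 (f j)) ->
  int1 (fun s => rsum n (fun j => f j s)) = rsum n (fun j => int1 (f j)).
Proof.
  intros H; induction n as [|n IH]; simpl; [apply int1_const|].
  rewrite int1_plus; [now rewrite IH|now apply cont1_rsum|apply H].
Qed.

Lemma rsum_ext n f g : (forall i, (i < n)%nat -> f i = g i) -> rsum n f = rsum n g.
Proof.
  intros H; induction n as [|n IH]; simpl; [reflexivity|].
  rewrite IH, H; auto.
Qed.

Lemma rsum_scal n c f : rsum n (fun i => c * f i) = c * rsum n f.
Proof. induction n as [|n IH]; simpl; [ring|rewrite IH; ring]. Qed.

Lemma rsum_plus n f g : rsum n (fun i => f i + g i) = rsum n f + rsum n g.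
Proof. induction n as [|n IH]; simpl; [ring|rewrite IH; ring]. Qed.

Lemma rsum_const n c : rsum n (fun _ => c) = INR n * c.
Proof. induction n as [|n IH]; [simpl; ring|]. rewrite S_INR; simpl rsum; rewrite IH; ring. Qed.

Lemma rsum_0 n : rsum n (fun _ => 0) = 0.
Proof. rewrite rsum_const; ring. Qed.

(** * The Fejer kernel and functions without Fourier coefficients in one variable *)

Definition dc (N : nat) (s : R) := rsum N (fun j => cos (2 * PI * INR j * s)).
Definition ds (N : nat) (s : R) := rsum N (fun j => sin (2 * PI * INR j * s)).

Lemma cos2_sin2 x : cos x * cos x + sin x * sin x = 1.
Proof. generalize (sin2_cos2 x); unfold Rsqr; lra. Qed.

(* |z - 1|^2 |1 + z + ... + z^(N-1)|^2 = |z^N - 1|^2 for z = exp(2 i pi s). *)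
Lemma fejer_bound N s :
  4 * (sin (PI * s) * sin (PI * s)) * (dc N s * dc N s + ds N s * ds N s) <= 4.
Proof.
  set (c := cos (2 * PI * s)); set (d := sin (2 * PI * s)).
  assert (Hc : c = 1 - 2 * (sin (PI * s) * sin (PI * s))).
  { unfold c; replace (2 * PI * s) with (2 * (PI * s)) by ring.
    rewrite cos_2a; generalize (cos2_sin2 (PI * s)); lra. }
  assert (Hcd : c * c + d * d = 1) by apply cos2_sin2.
  assert (Hgeo : (c - 1) * dc N s - d * ds N s = cos (2 * PI * INR N * s) - 1
      /\ (c - 1) * ds N s + d * dc N s = sin (2 * PI * INR N * s)).
  { induction N as [|N [IH1 IH2]].
    - unfold dc, ds; simpl; replace (2 * PI * 0 * s) with 0 by ring.
      rewrite cos_0, sin_0; lra.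
    - unfold dc, ds; simpl rsum; fold (dc N s) (ds N s).
      rewrite S_INR; replace (2 * PI * (INR N + 1) * s) with
        (2 * PI * INR N * s + 2 * PI * s) by ring.
      rewrite cos_plus, sin_plus; fold c d.
      split; nra. }
  destruct Hgeo as [H1 H2].
  set (A := dc N s) in *; set (B := ds N s) in *.
  assert (E : 4 * (sin (PI * s) * sin (PI * s)) * (A * A + B * B) =
    ((c - 1) * A - d * B) * ((c - 1) * A - d * B) +
    ((c - 1) * B + d * A) * ((c - 1) * B + d * A)).
  { replace (4 * (sin (PI * s) * sin (PI * s))) with (2 * (1 - c)) by lra.
    replace (2 * (1 - c)) with ((c - 1) * (c - 1) + d * d) by lra. ring. }
  rewrite E, H1, H2.
  generalize (cos2_sin2 (2 * PI * INR N * s)), (COS_bound (2 * PI * INR N * s)); nra.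
Qed.

(** Since cos a cos b + sin a sin b = cos (a - b), the squared modulus of the geometric sum contains
    only cosines of frequency differences. Testing a function against the kernel therefore involves
    its cosine coefficients alone. *)
Lemma fejer_sum N s : dc N s * dc N s + ds N s * ds N s =
  rsum N (fun j => rsum N (fun l => cos (2 * PI * IZR (Z.of_nat j - Z.of_nat l) * s))).
Proof.
  transitivity (rsum N (fun j => rsum N (fun l =>
     cos (2 * PI * INR j * s) * cos (2 * PI * INR l * s) +
     sin (2 * PI * INR j * s) * sin (2 * PI * INR l * s)))).
  - transitivity (rsum N (fun j => dc N s * cos (2 * PI * INR j * s) + ds N s * sin (2 * PI * INR j * s))).
    { rewrite rsum_plus, !rsum_scal; reflexivity. }
    apply rsum_ext; intros j _.
    rewrite rsum_plus, !rsum_scal; fold (dc N s) (ds N s); ring.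
  - apply rsum_ext; intros j _; apply rsum_ext; intros l _.
    rewrite minus_IZR, <- !INR_IZR_INZ, <- cos_minus; f_equal; ring.
Qed.

Lemma IZR_periodic_cos (m : Z) : cos (2 * PI * IZR m) = 1.
Proof.
  assert (P : forall k, cos (2 * PI * INR k) = 1).
  { intros k; replace (2 * PI * INR k) with (0 + 2 * INR k * PI) by ring.
    rewrite cos_period; apply cos_0. }
  destruct (Z_le_gt_dec 0 m) as [H|H].
  - rewrite <- (Z2Nat.id m H), <- INR_IZR_INZ; apply P.
  - replace m with (- Z.of_nat (Z.to_nat (- m)))%Z by (rewrite Z2Nat.id; lia).
    rewrite opp_IZR, <- INR_IZR_INZ.
    replace (2 * PI * - INR (Z.to_nat (- m))) with (- (2 * PI * INR (Z.to_nat (- m)))) by ring.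
    rewrite cos_neg; apply P.
Qed.

Lemma IZR_periodic_sin (m : Z) : sin (2 * PI * IZR m) = 0.
Proof. generalize (cos2_sin2 (2 * PI * IZR m)); rewrite IZR_periodic_cos; nra. Qed.

Lemma int1_cos (m : Z) : int1 (fun s => cos (2 * PI * IZR m * s)) = if Z.eqb m 0 then 1 else 0.
Proof.
  destruct (Z.eqb_spec m 0) as [->|Hm].
  - transitivity (int1 (fun _ => 1)); [|apply int1_const]; apply int1_ext; intros s.
    replace (2 * PI * 0 * s) with 0 by ring; apply cos_0.
  - assert (Hk : 2 * PI * IZR m <> 0).
    { generalize PI_neq0; apply not_0_IZR in Hm; intros; apply Rmult_integral_contrapositive_currified; [apply Rmult_integral_contrapositive_currified; [lra|assumption]|assumption]. }
    apply is_RInt_unique.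
    replace 0 with (minus (sin (2 * PI * IZR m * 1) / (2 * PI * IZR m)) (sin (2 * PI * IZR m * 0) / (2 * PI * IZR m))) at 2.
    + apply (is_RInt_derive (fun s => sin (2 * PI * IZR m * s) / (2 * PI * IZR m))).
      * intros x _; auto_derive; [exact I|field; exact (conj (not_0_IZR _ Hm) PI_neq0)].
      * intros x _; revert x; change (cont1 (fun s => cos (2 * PI * IZR m * s))); cont1.
    + unfold minus, plus, opp; simpl.
      rewrite Rmult_1_r, Rmult_0_r, IZR_periodic_sin, sin_0; field; exact (conj (not_0_IZR _ Hm) PI_neq0).
Qed.

Lemma int1_sin (m : Z) : int1 (fun s => sin (2 * PI * IZR m * s)) = 0.
Proof.
  destruct (Z.eq_dec m 0) as [->|Hm].
  - transitivity (int1 (fun _ => 0)); [|apply int1_const]; apply int1_ext; intros s.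
    replace (2 * PI * 0 * s) with 0 by ring; apply sin_0.
  - assert (Hk : 2 * PI * IZR m <> 0).
    { generalize PI_neq0; apply not_0_IZR in Hm; intros; apply Rmult_integral_contrapositive_currified; [apply Rmult_integral_contrapositive_currified; [lra|assumption]|assumption]. }
    apply is_RInt_unique.
    replace 0 with (minus (- cos (2 * PI * IZR m * 1) / (2 * PI * IZR m)) (- cos (2 * PI * IZR m * 0) / (2 * PI * IZR m))) at 2.
    + apply (is_RInt_derive (fun s => - cos (2 * PI * IZR m * s) / (2 * PI * IZR m))).
      * intros x _; auto_derive; [exact I|field; exact (conj (not_0_IZR _ Hm) PI_neq0)].
      * intros x _; revert x; change (cont1 (fun s => sin (2 * PI * IZR m * s))); cont1.
    + unfold minus, plus, opp; simpl.
      rewrite Rmult_1_r, Rmult_0_r, IZR_periodic_cos, cos_0; field; exact (conj (not_0_IZR _ Hm) PI_neq0).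
Qed.

Lemma rsum_delta N j (c : R) : (j < N)%nat ->
  rsum N (fun l => if Z.eqb (Z.of_nat j - Z.of_nat l) 0 then c else 0) = c.
Proof.
  assert (Z0 : forall M, (M <= j)%nat ->
    rsum M (fun l => if Z.eqb (Z.of_nat j - Z.of_nat l) 0 then c else 0) = 0).
  { intros M HM; transitivity (rsum M (fun _ => 0)); [|apply rsum_0]; apply rsum_ext; intros l Hl.
    destruct (Z.eqb_spec (Z.of_nat j - Z.of_nat l) 0); [lia|reflexivity]. }
  induction N as [|N IH]; [lia|]; intros Hj; simpl.
  destruct (Nat.eq_dec j N) as [->|Hn].
  - rewrite Z0 by lia; rewrite Z.sub_diag; simpl; ring.
  - rewrite IH by lia; destruct (Z.eqb_spec (Z.of_nat j - Z.of_nat N) 0); [lia|ring].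
Qed.

Definition fejer (N : nat) (s : R) := / INR N * (dc N s * dc N s + ds N s * ds N s).

Lemma cont1_dc N : cont1 (dc N).
Proof. unfold dc; cont1. Qed.
Lemma cont1_ds N : cont1 (ds N).
Proof. unfold ds; cont1. Qed.
Lemma cont1_fejer N : cont1 (fejer N).
Proof. unfold fejer; generalize (cont1_dc N) (cont1_ds N); intros; cont1. Qed.

(** Of the pairs (j, l), the N diagonal ones contribute [int1 g] each, which / N averages out, and
    the others contribute nothing. The hypothesis is phrased so as to cover both the constant 1,
    which gives the mass of the kernel, and a function all of whose cosine coefficients vanish. *)
Lemma int1_fejer_mult N g : cont1 g ->
  (forall m, int1 (fun s => g s * cos (2 * PI * IZR m * s)) = if Z.eqb m 0 then int1 g else 0) ->
  (0 < N)%nat -> int1 (fun s => g s * fejer N s) = int1 g.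
Proof.
  intros Hg Hm HN.
  assert (HN' : INR N <> 0) by (apply not_0_INR; lia).
  transitivity (int1 (fun s => / INR N * rsum N (fun j => rsum N (fun l =>
     g s * cos (2 * PI * IZR (Z.of_nat j - Z.of_nat l) * s))))).
  { apply int1_ext; intros s; unfold fejer; rewrite fejer_sum.
    rewrite <- Rmult_assoc, (Rmult_comm (g s)), Rmult_assoc; f_equal.
    rewrite <- rsum_scal; apply rsum_ext; intros j _; now rewrite <- rsum_scal. }
  rewrite int1_scal by cont1.
  rewrite int1_rsum by (intro; cont1).
  rewrite (rsum_ext N _ (fun _ => int1 g)).
  - rewrite rsum_const; field; exact HN'.
  - intros j Hj; rewrite int1_rsum by (intro; cont1).
    rewrite <- (rsum_delta N j (int1 g) Hj).
    apply rsum_ext; intros l _; apply Hm.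
Qed.

Lemma int1_fejer N : (0 < N)%nat -> int1 (fejer N) = 1.
Proof.
  intros HN; rewrite <- (int1_const 1), <- (int1_fejer_mult N (fun _ => 1)); auto.
  - apply int1_ext; intros; ring.
  - apply cont1_const.
  - intros m; rewrite int1_const, <- (int1_cos m); apply int1_ext; intros; ring.
Qed.

Lemma fejer_ge0 N s : (0 < N)%nat -> 0 <= fejer N s.
Proof.
  intros HN; unfold fejer; apply Rmult_le_pos; [|nra].
  left; apply Rinv_0_lt_compat, lt_0_INR, HN.
Qed.

Lemma sin2_fejer N s : (0 < N)%nat -> sin (PI * s) * sin (PI * s) * fejer N s <= / INR N.
Proof.
  intros HN; unfold fejer; generalize (fejer_bound N s).
  assert (0 < / INR N) by (apply Rinv_0_lt_compat, lt_0_INR, HN). nra.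
Qed.

Lemma cont1_bounded g : cont1 g -> exists B, 0 < B /\ forall s, 0 <= s <= 1 -> Rabs (g s) <= B.
Proof.
  intros Hg.
  destruct (continuity_ab_maj (fun s => Rabs (g s)) 0 1) as [M [HM _]]; [lra| |].
  - intros c _; apply continuity_pt_filterlim; apply (cont1_Rabs g Hg).
  - exists (Rabs (g M) + 1); split; [generalize (Rabs_pos (g M)); lra|].
    intros s Hs; specialize (HM s Hs); simpl in HM; lra.
Qed.

Lemma sin_PI_lower d s : 0 < d -> d <= s <= 1 - d -> sin (PI * d) <= sin (PI * s).
Proof.
  intros Hd Hs; generalize PI_RGT_0; intros HP.
  assert (HPd : 0 < PI * d) by nra.
  assert (PI * d <= PI * s) by nra.
  assert (PI * s <= PI - PI * d) by nra.
  destruct (Rle_dec (PI * s) (PI / 2)).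
  - apply sin_incr_1; lra.
  - rewrite <- (sin_PI_x (PI * s)); apply sin_incr_1; lra.
Qed.

(* Fejer's argument: |g s - g 0| <= eps + M sin^2 (pi s), and the kernel has mass 1 while
   its product with sin^2 (pi s) is at most 1 / N. *)
Lemma vanishing_coefs_at0 g : cont1 g -> g 1 = g 0 ->
  (forall m, int1 (fun s => g s * cos (2 * PI * IZR m * s)) = 0) -> g 0 = 0.
Proof.
  intros Hg H10 Hm.
  destruct (Req_dec (g 0) 0) as [|Hn]; [assumption|exfalso].
  set (eps := Rabs (g 0) / 2).
  assert (Heps : 0 < eps) by (apply Rabs_pos_lt in Hn; unfold eps; lra).
  assert (HC : forall c, exists d, 0 < d /\ forall s, Rabs (s - c) < d -> Rabs (g s - g c) < eps).
  { intros c.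
    assert (Hc : continuity_pt g c) by (apply continuity_pt_filterlim, Hg).
    destruct (Hc eps Heps) as [d [Hd H]].
    exists d; split; [exact Hd|]; intros s Hs.
    destruct (Req_dec s c) as [->|Hsc]; [rewrite Rminus_diag, Rabs_R0; exact Heps|].
    apply (H s); split; [split; [exact I|auto]|exact Hs]. }
  destruct (HC 0) as [d0 [Hd0 H0]], (HC 1) as [d1 [Hd1 H1]].
  set (d := Rmin (Rmin d0 d1) (1/2) / 2).
  assert (Hd : 0 < d /\ d < d0 /\ d < d1 /\ d < 1/2).
  { assert (0 < Rmin (Rmin d0 d1) (1/2)) by (repeat apply Rmin_pos; lra).
    generalize (Rmin_l (Rmin d0 d1) (1/2)) (Rmin_r (Rmin d0 d1) (1/2)) (Rmin_l d0 d1) (Rmin_r d0 d1).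
    unfold d; lra. }
  destruct (cont1_bounded g Hg) as [B [HB HBg]].
  set (q := sin (PI * d)).
  assert (Hq : 0 < q) by (generalize PI_RGT_0; intros; apply sin_gt_0; nra).
  (* Between d and 1 - d the difference |g s - g 0| is at most 2 B while sin^2 (pi s) is at least
     q^2, whence this M. Near 0 continuity suffices, and near 1 continuity together with g 1 = g
     0. *)
  set (M := 2 * B / (q * q)).
  assert (HM : 0 < M) by (unfold M; apply Rdiv_lt_0_compat; nra).
  assert (Hest : forall s, 0 <= s <= 1 -> Rabs (g s - g 0) <= eps + M * (sin (PI * s) * sin (PI * s))).
  { intros s Hs.
    assert (Hs2 : 0 <= M * (sin (PI * s) * sin (PI * s))) by (apply Rmult_le_pos; nra).
    destruct (Rlt_dec s d) as [L|L].
    - specialize (H0 s); rewrite Rminus_0_r, Rabs_right in H0 by lra.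
      assert (s < d0) by lra; specialize (H0 H); lra.
    - destruct (Rlt_dec (1 - d) s) as [L'|L'].
      + specialize (H1 s); rewrite H10 in H1.
        assert (Rabs (s - 1) < d1) by (rewrite Rabs_left1; lra). specialize (H1 H); lra.
      + assert (Hqs : q <= sin (PI * s)) by (apply sin_PI_lower; lra).
        assert (2 * B <= M * (sin (PI * s) * sin (PI * s))).
        { replace (2 * B) with (M * (q * q)) by (unfold M; field; lra).
          apply Rmult_le_compat_l; nra. }
        assert (Rabs (g s - g 0) <= Rabs (g s) + Rabs (g 0)).
        { unfold Rminus; eapply Rle_trans; [apply Rabs_triang|rewrite Rabs_Ropp; lra]. }
        generalize (HBg s Hs) (HBg 0 ltac:(lra)); lra. }
  assert (Hmain : forall N, (0 < N)%nat -> Rabs (g 0) <= eps + M * / INR N).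
  { intros N HN.
    assert (HF := cont1_fejer N).
    assert (I0 : int1 g = 0).
    { rewrite <- (Hm 0%Z); apply int1_ext; intros s; replace (2 * PI * 0 * s) with 0 by ring; rewrite cos_0; ring. }
    assert (I1 : int1 (fun s => (g s - g 0) * fejer N s) = - g 0).
    { rewrite (int1_ext _ (fun s => g s * fejer N s - g 0 * fejer N s)) by (intros; ring).
      rewrite int1_minus by cont1.
      rewrite int1_scal by cont1; rewrite int1_fejer by exact HN.
      rewrite int1_fejer_mult; [rewrite I0; ring|exact Hg| |exact HN].
      intros m; rewrite Hm; destruct (Z.eqb m 0); lra. }
    rewrite <- Rabs_Ropp, <- I1.
    eapply Rle_trans.
    { unfold int1; apply abs_RInt_le; [lra|]. apply cont1_ex_RInt; cont1. }
    change (int1 (fun s => Rabs ((g s - g 0) * fejer N s)) <= eps + M * / INR N).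
    eapply Rle_trans with (int1 (fun s => eps * fejer N s + M * / INR N)).
    - apply int1_le; [cont1..|].
      intros s Hs; rewrite Rabs_mult, (Rabs_right (fejer N s)) by (apply Rle_ge, fejer_ge0, HN).
      generalize (Hest s Hs) (fejer_ge0 N s HN) (sin2_fejer N s HN); intros E1 E2 E3.
      apply Rle_trans with ((eps + M * (sin (PI * s) * sin (PI * s))) * fejer N s); [nra|].
      replace ((eps + M * (sin (PI * s) * sin (PI * s))) * fejer N s) with
        (eps * fejer N s + M * (sin (PI * s) * sin (PI * s) * fejer N s)) by ring.
      nra.
    - rewrite int1_plus by cont1; rewrite int1_scal by cont1.
      rewrite int1_fejer, int1_const by exact HN; lra. }
  (* With M / N < eps / 2 and eps = |g 0| / 2, the bound reads |g 0| < 3/4 |g 0|. *)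
  destruct (archimed_cor1 (eps / (2 * M))) as [N [HN HN0]].
  { apply Rdiv_lt_0_compat; lra. }
  specialize (Hmain N HN0).
  assert (M * / INR N < eps / 2).
  { replace (eps / 2) with (M * (eps / (2 * M))) by (field; lra). now apply Rmult_lt_compat_l. }
  unfold eps in *; lra.
Qed.

(** * Restriction to lines and averages along a direction in several variables *)

Definition line (x : Pt) (s : R) (v : Pt) : Pt := fun i => x i + s * v i.

Lemma cont1_eps g : (forall s eps, 0 < eps -> exists d, 0 < d /\
  forall t, Rabs (t - s) < d -> Rabs (g t - g s) < eps) -> cont1 g.
Proof.
  intros H s; apply continuity_pt_filterlim; intros eps Heps.
  destruct (H s eps Heps) as [d [Hd Hd']].
  exists d; split; [exact Hd|]; intros t [_ Ht]; now apply Hd'.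
Qed.

Lemma cont1_eps_inv g : cont1 g -> forall s eps, 0 < eps -> exists d, 0 < d /\
  forall t, Rabs (t - s) < d -> Rabs (g t - g s) < eps.
Proof.
  intros Hg s eps Heps.
  assert (Hc : continuity_pt g s) by (apply continuity_pt_filterlim, Hg).
  destruct (Hc eps Heps) as [d [Hd H]].
  exists d; split; [exact Hd|]; intros t Ht.
  destruct (Req_dec t s) as [->|Hsc]; [rewrite Rminus_diag, Rabs_R0; exact Heps|].
  apply (H t); split; [split; [exact I|auto]|exact Ht].
Qed.

(** Points that agree on the first n coordinates lie within every delta of each other, so [cont_n]
    already forces independence of the remaining coordinates. *)
Lemma cont_n_ext n g x y : cont_n n g -> (forall i, (i < n)%nat -> x i = y i) -> g x = g y.
Proof.
  intros Hg Hxy; destruct (Req_dec (g x) (g y)) as [|Hn]; [assumption|exfalso].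
  assert (He : 0 < Rabs (g x - g y)) by (apply Rabs_pos_lt; lra).
  destruct (Hg y _ He) as [d [Hd H]].
  specialize (H x); assert (Rabs (g x - g y) < Rabs (g x - g y)); [|lra].
  apply H; intros i Hi; rewrite Hxy, Rminus_diag, Rabs_R0 by exact Hi; exact Hd.
Qed.

Lemma bound_n n (v : Pt) : exists V, 0 < V /\ forall i, (i < n)%nat -> Rabs (v i) <= V.
Proof.
  induction n as [|n [V [HV H]]]; [exists 1; split; [lra|lia]|].
  exists (V + Rabs (v n)); generalize (Rabs_pos (v n)); intros Hp; split; [lra|].
  intros i Hi; destruct (Nat.eq_dec i n) as [->|]; [lra|].
  specialize (H i ltac:(lia)); lra.
Qed.

Lemma cont_n_plus n f g : cont_n n f -> cont_n n g -> cont_n n (fun x => f x + g x).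
Proof.
  intros Hf Hg x eps He.
  destruct (Hf x (eps/2)) as [d [Hd H]], (Hg x (eps/2)) as [d' [Hd' H']]; try lra.
  exists (Rmin d d'); split; [now apply Rmin_pos|]; intros y Hy.
  assert (A : Rabs (f y - f x) < eps/2).
  { apply H; intros i Hi; eapply Rlt_le_trans; [apply Hy, Hi|apply Rmin_l]. }
  assert (B : Rabs (g y - g x) < eps/2).
  { apply H'; intros i Hi; eapply Rlt_le_trans; [apply Hy, Hi|apply Rmin_r]. }
  replace (f y + g y - (f x + g x)) with ((f y - f x) + (g y - g x)) by ring.
  eapply Rle_lt_trans; [apply Rabs_triang|lra].
Qed.

Lemma cont_n_scal n c f : cont_n n f -> cont_n n (fun x => c * f x).
Proof.
  intros Hf x eps He.
  assert (Hc : 0 < Rabs c + 1) by (generalize (Rabs_pos c); lra).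
  destruct (Hf x (eps / (Rabs c + 1))) as [d [Hd H]]; [now apply Rdiv_lt_0_compat|].
  exists d; split; [exact Hd|]; intros y Hy; specialize (H y Hy).
  replace (c * f y - c * f x) with (c * (f y - f x)) by ring; rewrite Rabs_mult.
  apply Rle_lt_trans with ((Rabs c + 1) * Rabs (f y - f x)).
  - apply Rmult_le_compat_r; [apply Rabs_pos|lra].
  - replace eps with ((Rabs c + 1) * (eps / (Rabs c + 1))) by (field; lra).
    now apply Rmult_lt_compat_l.
Qed.

Lemma cont_n_minus n f g : cont_n n f -> cont_n n g -> cont_n n (fun x => f x - g x).
Proof.
  intros Hf Hg.
  replace (fun x => f x - g x) with (fun x => f x + -1 * g x)
    by (apply functional_extensionality; intros; ring).
  apply cont_n_plus; [|apply cont_n_scal]; assumption.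
Qed.

(** Compactness of [0, 1] makes the modulus of continuity uniform along the segment. The radius d +
    d V leaves room for two displacements at once: of the base point, by d, and of the parameter, by
    d times the bound V on the coordinates of v. *)
Lemma unif_line n u x v eps : cont_n n u -> 0 < eps ->
  exists d, 0 < d /\ forall y, (forall i, (i < n)%nat -> Rabs (y i - x i) < d) ->
    forall s, 0 <= s <= 1 -> Rabs (u (line y s v) - u (line x s v)) < eps.
Proof.
  intros Hu He.
  destruct (bound_n n v) as [V [HV HVi]].
  assert (He2 : 0 < eps / 2) by lra.
  assert (HC : forall t, exists d : posreal, forall y,
     (forall i, (i < n)%nat -> Rabs (y i - line x t v i) < d + d * V) ->
     Rabs (u y - u (line x t v)) < eps / 2).
  { intros t; destruct (Hu (line x t v) _ He2) as [d [Hd H]].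
    assert (Hd2 : 0 < d / (1 + V)) by (apply Rdiv_lt_0_compat; lra).
    exists (mkposreal _ Hd2); simpl; intros y Hy; apply H; intros i Hi.
    replace d with (d / (1 + V) + d / (1 + V) * V) by (field; lra). now apply Hy. }
  destruct (functional_choice _ HC) as [del Hdel].
  destruct (compactness_value_1d 0 1 del) as [d Hd].
  exists d; split; [apply cond_pos|]; intros y Hy s Hs.
  apply NNPP; intros HN; apply (Hd s Hs); intros [t [_ [Hst Hdt]]]; apply HN.
  assert (K : forall z, (forall i, (i < n)%nat -> Rabs (z i - x i) < d) ->
     Rabs (u (line z s v) - u (line x t v)) < eps / 2).
  { intros z Hz; apply Hdel; intros i Hi; unfold line.
    replace (z i + s * v i - (x i + t * v i)) with ((z i - x i) + (s - t) * v i) by ring.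
    eapply Rle_lt_trans; [apply Rabs_triang|]; rewrite Rabs_mult.
    specialize (Hz i Hi); specialize (HVi i Hi).
    assert (Rabs (s - t) * Rabs (v i) <= del t * V); [|lra].
    apply Rmult_le_compat; try apply Rabs_pos; lra. }
  assert (K2 : Rabs (u (line x s v) - u (line x t v)) < eps / 2).
  { apply K; intros; rewrite Rminus_diag, Rabs_R0; apply cond_pos. }
  specialize (K y Hy).
  replace (u (line y s v) - u (line x s v)) with
    ((u (line y s v) - u (line x t v)) - (u (line x s v) - u (line x t v))) by ring.
  unfold Rminus at 1; eapply Rle_lt_trans; [apply Rabs_triang|rewrite Rabs_Ropp; lra].
Qed.

(** Joint continuity in the differentiation variable t and the integration variable s is what
    differentiation under the integral sign asks for. *)
Lemma cont_n_shift_line n u x v i t0 s0 : cont_n n u ->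
  continuity_2d_pt (fun t s => u (shift (line x s v) i t)) t0 s0.
Proof.
  intros Hu eps.
  destruct (Hu (shift (line x s0 v) i t0) eps (cond_pos eps)) as [d [Hd H]].
  destruct (bound_n n v) as [V [HV HVi]].
  assert (Hd2 : 0 < d / (1 + V)) by (apply Rdiv_lt_0_compat; lra).
  exists (mkposreal _ Hd2); simpl; intros t s Ht Hs; apply H; intros j Hj.
  assert (E : d = d / (1 + V) + d / (1 + V) * V) by (field; lra).
  specialize (HVi j Hj).
  assert (Hsv : Rabs ((s - s0) * v j) <= d / (1 + V) * V).
  { rewrite Rabs_mult; apply Rmult_le_compat; try apply Rabs_pos; lra. }
  unfold shift, line; destruct (Nat.eqb j i).
  - replace (x j + s * v j + t - (x j + s0 * v j + t0)) with ((t - t0) + (s - s0) * v j) by ring.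
    eapply Rle_lt_trans; [apply Rabs_triang|lra].
  - replace (x j + s * v j - (x j + s0 * v j)) with ((s - s0) * v j) by ring. lra.
Qed.

Lemma cont_n_line n u x v : cont_n n u -> cont1 (fun s => u (line x s v)).
Proof.
  intros Hu; apply cont1_eps; intros s eps He.
  (* Direction n lies outside the coordinates 0, ..., n - 1, so shifting along it changes nothing
     that u can see. *)
  destruct (cont_n_shift_line n u x v n 0 s Hu (mkposreal _ He)) as [d H].
  exists d; split; [apply cond_pos|]; intros t Ht.
  assert (E : forall r, u (line x r v) = u (shift (line x r v) n 0)).
  { intros r; apply (cont_n_ext n); [exact Hu|]; intros j Hj; unfold shift.
    destruct (Nat.eqb_spec j n); [lia|reflexivity]. }
  rewrite !E; apply H; [rewrite Rminus_diag, Rabs_R0; apply cond_pos|exact Ht].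
Qed.

Definition avg (c : R -> R) (v : Pt) (u : Pt -> R) : Pt -> R :=
  fun x => int1 (fun s => u (line x s v) * c s).

Lemma avg_cont n c v u : cont1 c -> cont_n n u -> cont_n n (avg c v u).
Proof.
  intros Hc Hu x eps He.
  destruct (cont1_bounded c Hc) as [B [HB HBc]].
  destruct (unif_line n u x v (eps / (2 * B)) Hu) as [d [Hd H]].
  { apply Rdiv_lt_0_compat; lra. }
  exists d; split; [exact Hd|]; intros y Hy; unfold avg.
  assert (Cx := cont_n_line n u x v Hu); assert (Cy := cont_n_line n u y v Hu).
  rewrite <- int1_minus by cont1.
  apply Rle_lt_trans with ((1 - 0) * (eps / 2)); [|lra].
  apply abs_RInt_le_const; [lra|apply cont1_ex_RInt; cont1|].
  intros s Hs; specialize (H y Hy s Hs); specialize (HBc s Hs).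
  replace (u (line y s v) * c s - u (line x s v) * c s) with
    ((u (line y s v) - u (line x s v)) * c s) by ring.
  rewrite Rabs_mult; replace (eps / 2) with (eps / (2 * B) * B) by (field; lra).
  apply Rmult_le_compat; try apply Rabs_pos; lra.
Qed.

Lemma shift_shift x i s t : shift (shift x i s) i t = shift x i (s + t).
Proof.
  apply functional_extensionality; intros j; unfold shift.
  destruct (Nat.eqb j i); ring.
Qed.

Lemma line_shift x i t s v : line (shift x i t) s v = shift (line x s v) i t.
Proof.
  apply functional_extensionality; intros j; unfold shift, line.
  destruct (Nat.eqb j i); ring.
Qed.

(** [pd] speaks of the derivative at parameter 0 only. Moving the base point to [shift x i t] gives
    it at every t. *)
Lemma pd_is_derive i u g x t : pd i u g ->
  is_derive (fun r => u (shift x i r)) t (g (shift x i t)).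
Proof.
  intros H; specialize (H (shift x i t)); apply is_derive_Reals in H.
  apply is_derive_ext with (fun r => u (shift (shift x i t) i (r - t))).
  - intros r; rewrite shift_shift; do 2 f_equal; ring.
  - replace (g (shift x i t)) with (scal 1 (g (shift x i t)))
      by (unfold scal; simpl; unfold mult; simpl; ring).
    apply (is_derive_comp (fun r => u (shift (shift x i t) i r)) (fun r => r - t)).
    + rewrite Rminus_diag; exact H.
    + auto_derive; [exact I|ring].
Qed.

(** Differentiation under the integral sign. Continuity of g is assumed because the derivative of
    the integrand must be jointly continuous; smoothness of the forms will supply it. *)
Lemma avg_pd n i c v u g : cont1 c -> cont_n n u -> cont_n n g -> pd i u g ->
  pd i (avg c v u) (avg c v g).
Proof.
  intros Hc Hu Hg Hp x; apply is_derive_Reals.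
  assert (D : forall t s, is_derive (fun r => u (shift (line x s v) i r) * c s) t
     (g (shift (line x s v) i t) * c s)).
  { intros t s; generalize (pd_is_derive i u g (line x s v) t Hp); intros D.
    apply is_derive_ext with (fun r => scal (c s) (u (shift (line x s v) i r))).
    - intros; unfold scal; simpl; unfold mult; simpl; ring.
    - replace (g (shift (line x s v) i t) * c s) with (scal (c s) (g (shift (line x s v) i t)))
        by (unfold scal; simpl; unfold mult; simpl; ring).
      apply is_derive_scal, D. }
  apply is_derive_ext with (fun t => RInt (fun s => u (shift (line x s v) i t) * c s) 0 1).
  { intros t; unfold avg, int1; apply RInt_ext; intros; now rewrite line_shift. }
  replace (avg c v g x) with
    (RInt (fun s => Derive (fun r => u (shift (line x s v) i r) * c s) 0) 0 1).
  - apply (is_derive_RInt_param (fun t s => u (shift (line x s v) i t) * c s)).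
    + apply filter_forall; intros t s _; eexists; apply D.
    + intros s _; apply continuity_2d_pt_ext with (fun t r => g (shift (line x r v) i t) * c r).
      { intros; symmetry; apply is_derive_unique, D. }
      apply continuity_2d_pt_mult; [apply (cont_n_shift_line n), Hg|].
      apply (continuity_1d_2d_pt_comp c (fun _ r => r)); [|apply continuity_2d_pt_id2].
      apply continuity_pt_filterlim, Hc.
    + apply filter_forall; intros t; apply cont1_ex_RInt.
      apply cont1_mult; [|exact Hc].
      intros s; apply (continuous_ext (fun s => u (line (shift x i t) s v))).
      { intros r; now rewrite line_shift. }
      apply (cont_n_line n), Hu.
  - unfold avg, int1; apply RInt_ext; intros s _.
    etransitivity; [apply is_derive_unique, (D 0 s)|]; f_equal.
    apply (cont_n_ext n g); [exact Hg|]; intros j _; unfold shift.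
    destruct (Nat.eqb j i); ring.
Qed.

Lemma int1_shift g t : cont1 g -> (forall s, g (s + 1) = g s) ->
  int1 (fun s => g (s + t)) = int1 g.
Proof.
  intros Hg Hp.
  assert (S : forall a b r, RInt (fun s => g (s + r)) a b = RInt g (a + r) (b + r)).
  { intros a b r; replace (a + r) with (1 * a + r) by ring; replace (b + r) with (1 * b + r) by ring.
    rewrite <- RInt_comp_lin by (apply cont1_ex_RInt, Hg).
    apply RInt_ext; intros s _; unfold scal; simpl; unfold mult; simpl.
    rewrite Rmult_1_l; f_equal; ring. }
  unfold int1; rewrite S, Rplus_0_l.
  assert (E : forall a b, ex_RInt g a b) by (intros; apply cont1_ex_RInt, Hg).
  rewrite <- (RInt_Chasles g t 1 (1 + t)) by apply E.
  rewrite <- (RInt_Chasles g t 0 1) by apply E.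
  assert (E2 : RInt g 1 (1 + t) = RInt g 0 t).
  { transitivity (RInt (fun s => g (s + 1)) 0 t).
    - rewrite S; f_equal; ring.
    - apply RInt_ext; intros; apply Hp. }
  rewrite E2, <- (opp_RInt_swap g 0 t) by apply E.
  unfold plus, opp; simpl; ring.
Qed.

(** * Complex characters and Fourier projections along one direction *)

Definition cexp (t : R) : Cx := (cos (2 * PI * t), sin (2 * PI * t)).

Lemma cexp_add s t : cexp (s + t) = cmul (cexp s) (cexp t).
Proof.
  unfold cexp, cmul; simpl; rewrite Rmult_plus_distr_l, cos_plus, sin_plus; f_equal; ring.
Qed.

Lemma cexp_Z m : cexp (IZR m) = (1, 0).
Proof. unfold cexp; now rewrite IZR_periodic_cos, IZR_periodic_sin. Qed.

Lemma cexp_0 : cexp 0 = (1, 0).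
Proof. apply (cexp_Z 0). Qed.

Lemma Cx_eq (z w : Cx) : fst z = fst w -> snd z = snd w -> z = w.
Proof. destruct z, w; simpl; congruence. Qed.

Ltac cx := intros; apply Cx_eq; unfold cadd, cmul, cscal, cI, c0; simpl; ring.

Lemma cmulA a b c : cmul a (cmul b c) = cmul (cmul a b) c. Proof. cx. Qed.
Lemma cmulC a b : cmul a b = cmul b a. Proof. cx. Qed.
Lemma cmul1 a : cmul (1, 0) a = a. Proof. cx. Qed.
Lemma cmulr1 a : cmul a (1, 0) = a. Proof. cx. Qed.
Lemma cmulr0 a : cmul a c0 = c0. Proof. cx. Qed.
Lemma cmul0 a : cmul c0 a = c0. Proof. cx. Qed.
Lemma cmulDr a b c : cmul a (cadd b c) = cadd (cmul a b) (cmul a c). Proof. cx. Qed.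
Lemma cmulDl a b c : cmul (cadd a b) c = cadd (cmul a c) (cmul b c). Proof. cx. Qed.
Lemma caddr0 a : cadd a c0 = a. Proof. cx. Qed.
Lemma cadd0 a : cadd c0 a = a. Proof. cx. Qed.
Lemma caddA a b c : cadd a (cadd b c) = cadd (cadd a b) c. Proof. cx. Qed.
Lemma cscalE r z : cscal r z = cmul (r, 0) z. Proof. cx. Qed.
Lemma cIE z : cI z = cmul (0, 1) z. Proof. cx. Qed.

Definition ccont n (f : Pt -> Cx) : Prop :=
  cont_n n (fun x => fst (f x)) /\ cont_n n (fun x => snd (f x)).
Definition cpd i (f g : Pt -> Cx) : Prop :=
  pd i (fun x => fst (f x)) (fun x => fst (g x)) /\
  pd i (fun x => snd (f x)) (fun x => snd (g x)).

Lemma ccont_add n f g : ccont n f -> ccont n g -> ccont n (fun x => cadd (f x) (g x)).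
Proof. intros [] []; split; apply cont_n_plus; assumption. Qed.

Lemma ccont_mul n c f : ccont n f -> ccont n (fun x => cmul c (f x)).
Proof.
  intros []; split; simpl; [apply cont_n_minus|apply cont_n_plus]; try (now apply cont_n_scal).
Qed.

Lemma cont_n_0 n : cont_n n (fun _ => 0).
Proof. intros x eps He; exists 1; split; [lra|]; intros; rewrite Rminus_diag, Rabs_R0; exact He. Qed.

Lemma ccont_0 n : ccont n (fun _ => c0).
Proof. split; apply cont_n_0. Qed.

(* For f with period v, [proj v m f] is the component of f satisfying
   f (x + t v) = exp (2 i pi m t) f x, see [proj_char]. *)
Definition proj (v : Pt) (m : Z) (f : Pt -> Cx) : Pt -> Cx := fun x =>
  (int1 (fun s => fst (cmul (f (line x s v)) (cexp (- (IZR m * s))))),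
   int1 (fun s => snd (cmul (f (line x s v)) (cexp (- (IZR m * s)))))).

Definition fcos (m : Z) (s : R) := cos (2 * PI * IZR m * s).
Definition fsin (m : Z) (s : R) := sin (2 * PI * IZR m * s).
Lemma cont1_fcos m : cont1 (fcos m).
Proof. unfold fcos; cont1. Qed.
Lemma cont1_fsin m : cont1 (fsin m).
Proof. unfold fsin; cont1. Qed.

Lemma cexp_neg m s : cexp (- (IZR m * s)) = (fcos m s, - fsin m s).
Proof.
  unfold cexp, fcos, fsin; rewrite <- cos_neg, <- sin_neg; f_equal; f_equal; ring.
Qed.

(** Reduction to four real averages, through which continuity and partial derivatives of the
    projection are inherited from [avg_cont] and [avg_pd]. *)
Lemma proj_avg n v m f : ccont n f -> proj v m f = fun x =>
  (avg (fcos m) v (fun x => fst (f x)) x + avg (fsin m) v (fun x => snd (f x)) x,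
   avg (fcos m) v (fun x => snd (f x)) x - avg (fsin m) v (fun x => fst (f x)) x).
Proof.
  intros [Hu Hv]; apply functional_extensionality; intros x; unfold proj, avg.
  assert (A := cont_n_line n _ x v Hu); assert (B := cont_n_line n _ x v Hv).
  assert (C := cont1_fcos m); assert (D := cont1_fsin m).
  rewrite <- int1_plus, <- int1_minus by cont1.
  f_equal; apply int1_ext; intros s; rewrite cexp_neg; unfold cmul; simpl; ring.
Qed.

Lemma proj_cont n v m f : ccont n f -> ccont n (proj v m f).
Proof.
  intros H; rewrite (proj_avg n) by exact H; destruct H as [Hu Hv].
  assert (C := cont1_fcos m); assert (D := cont1_fsin m).
  split; simpl; [apply cont_n_plus|apply cont_n_minus]; apply avg_cont; assumption.
Qed.

Lemma pd_plus i f g f' g' : pd i f f' -> pd i g g' -> pd i (fun x => f x + g x) (fun x => f' x + g' x).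
Proof. intros Hf Hg x; apply (derivable_pt_lim_plus _ _ 0 _ _ (Hf x) (Hg x)). Qed.

Lemma pd_minus i f g f' g' : pd i f f' -> pd i g g' -> pd i (fun x => f x - g x) (fun x => f' x - g' x).
Proof. intros Hf Hg x; apply (derivable_pt_lim_minus _ _ 0 _ _ (Hf x) (Hg x)). Qed.

Lemma proj_cpd n i v m f g : ccont n f -> ccont n g -> cpd i f g -> cpd i (proj v m f) (proj v m g).
Proof.
  intros Hf Hg [P1 P2]; rewrite (proj_avg n v m f Hf), (proj_avg n v m g Hg).
  destruct Hf, Hg.
  assert (C := cont1_fcos m); assert (D := cont1_fsin m).
  split; simpl; [apply pd_plus|apply pd_minus]; apply (avg_pd n); assumption.
Qed.

Lemma proj_add n v m f g : ccont n f -> ccont n g ->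
  proj v m (fun x => cadd (f x) (g x)) = fun x => cadd (proj v m f x) (proj v m g x).
Proof.
  intros [Hu Hv] [Hu' Hv']; apply functional_extensionality; intros x.
  assert (A := cont_n_line n _ x v Hu); assert (B := cont_n_line n _ x v Hv).
  assert (A' := cont_n_line n _ x v Hu'); assert (B' := cont_n_line n _ x v Hv').
  unfold proj, cadd, cmul, cexp; apply Cx_eq; simpl.
  all: rewrite <- int1_plus by cont1; apply int1_ext; intros s; ring.
Qed.

Lemma proj_mul n v m c f : ccont n f ->
  proj v m (fun x => cmul c (f x)) = fun x => cmul c (proj v m f x).
Proof.
  intros [Hu Hv]; apply functional_extensionality; intros x.
  assert (A := cont_n_line n _ x v Hu); assert (B := cont_n_line n _ x v Hv).
  unfold proj, cmul, cexp; apply Cx_eq; simpl.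
  all: rewrite <- !int1_scal by cont1.
  - rewrite <- int1_minus by cont1; apply int1_ext; intros s; ring.
  - rewrite <- int1_plus by cont1; apply int1_ext; intros s; ring.
Qed.

Lemma line_line x s v t w : line (line x s v) t w = line (line x t w) s v.
Proof. apply functional_extensionality; intros j; unfold line; ring. Qed.

Lemma line_add x s v t : line (line x s v) t v = line x (t + s) v.
Proof. apply functional_extensionality; intros j; unfold line; ring. Qed.

Lemma line_0 x v : line x 0 v = x.
Proof. apply functional_extensionality; intros j; unfold line; ring. Qed.

(** Translations along v and w commute and the projection is complex linear. So what has been
    achieved along one basis vector survives the projection along the next. *)
Lemma proj_equivar n v m f w t e x : ccont n f ->
  (forall x, f (line x t w) = cmul e (f x)) ->
  proj v m f (line x t w) = cmul e (proj v m f x).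
Proof.
  intros Hf He; generalize (proj_mul n v m e f Hf); intros E.
  apply (f_equal (fun h => h x)) in E; simpl in E; rewrite <- E; unfold proj.
  f_equal; apply int1_ext; intros s; now rewrite line_line, He.
Qed.

(** Translating by t v shifts the integration variable. The integrand F has period 1, so its
    integral over a period is unchanged, and the shift leaves behind only the factor exp (2 i pi m
    t). *)
Lemma proj_char n v m f t x : ccont n f -> (forall x, f (line x 1 v) = f x) ->
  proj v m f (line x t v) = cmul (cexp (IZR m * t)) (proj v m f x).
Proof.
  intros Hf Hper.
  generalize (proj_mul n v m (cexp (IZR m * t)) f Hf); intros E.
  apply (f_equal (fun h => h x)) in E; simpl in E; rewrite <- E; unfold proj.
  set (F := fun s => cmul (f (line x s v)) (cexp (- (IZR m * s)))).
  assert (HF : forall s, F (s + 1) = F s).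
  { intros s; unfold F; rewrite Rplus_comm, <- line_add, Hper; f_equal.
    replace (- (IZR m * (1 + s))) with (- (IZR m * s) + IZR (- m)) by (rewrite opp_IZR; ring).
    now rewrite cexp_add, cexp_Z, cmulr1. }
  assert (HFt : forall s, cmul (f (line (line x t v) s v)) (cexp (- (IZR m * s))) =
     cmul (cexp (IZR m * t)) (F (s + t))).
  { intros s; unfold F; rewrite line_add.
    rewrite (cmulC (f _)), (cmulC (f _)), cmulA; f_equal.
    rewrite <- cexp_add; f_equal; ring. }
  destruct Hf as [Hu Hv].
  assert (A := cont_n_line n _ x v Hu); assert (B := cont_n_line n _ x v Hv).
  assert (CF1 : cont1 (fun s => fst (F s))).
  { unfold F; intros s; eapply continuous_ext; [intros r; rewrite cexp_neg; reflexivity|].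
    revert s; unfold cmul; simpl; change (cont1 (fun s => fst (f (line x s v)) * fcos m s - snd (f (line x s v)) * - fsin m s)).
    assert (C := cont1_fcos m); assert (D := cont1_fsin m).
    replace (fun s => fst (f (line x s v)) * fcos m s - snd (f (line x s v)) * - fsin m s) with
     (fun s => fst (f (line x s v)) * fcos m s + snd (f (line x s v)) * fsin m s)
      by (apply functional_extensionality; intros; ring). cont1. }
  assert (CF2 : cont1 (fun s => snd (F s))).
  { unfold F; intros s; eapply continuous_ext; [intros r; rewrite cexp_neg; reflexivity|].
    revert s; unfold cmul; simpl; change (cont1 (fun s => fst (f (line x s v)) * - fsin m s + snd (f (line x s v)) * fcos m s)).
    assert (C := cont1_fcos m); assert (D := cont1_fsin m).
    replace (fun s => fst (f (line x s v)) * - fsin m s + snd (f (line x s v)) * fcos m s) with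
     (fun s => snd (f (line x s v)) * fcos m s - fst (f (line x s v)) * fsin m s)
      by (apply functional_extensionality; intros; ring). cont1. }
  set (e := cexp (IZR m * t)) in *.
  f_equal.
  - transitivity (int1 (fun s => fst (cmul e (F s)))).
    + rewrite (int1_ext _ (fun s => (fun r => fst (cmul e (F r))) (s + t)))
        by (intros s; now rewrite HFt).
      apply (int1_shift (fun r => fst (cmul e (F r)))); [unfold cmul; simpl; cont1|].
      intros s; now rewrite HF.
    + apply int1_ext; intros s; unfold F; now rewrite cmulA.
  - transitivity (int1 (fun s => snd (cmul e (F s)))).
    + rewrite (int1_ext _ (fun s => (fun r => snd (cmul e (F r))) (s + t)))
        by (intros s; now rewrite HFt).
      apply (int1_shift (fun r => snd (cmul e (F r)))); [unfold cmul; simpl; cont1|].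
      intros s; now rewrite HF.
    + apply int1_ext; intros s; unfold F; now rewrite cmulA.
Qed.

(** Adding the projections of frequencies m and -m cancels the sine terms and isolates the cosine
    coefficients of the real and imaginary parts of f along the line through x. The one-variable
    result then applies at parameter 0, which is x itself. *)
Lemma proj_unique n v f x : ccont n f -> (forall x, f (line x 1 v) = f x) ->
  (forall m, proj v m f x = c0) -> f x = c0.
Proof.
  intros Hf Hper H0.
  assert (H : forall m,
     int1 (fun s => fst (f (line x s v)) * fcos m s) = 0 /\
     int1 (fun s => snd (f (line x s v)) * fcos m s) = 0).
  { intros m; generalize (H0 m) (H0 (- m)%Z); rewrite !(proj_avg n) by exact Hf.
    unfold avg, c0; intros E1 E2; injection E1; injection E2; intros F1 F2 F3 F4.
    assert (G : forall u, int1 (fun s => u s * fcos (- m) s) = int1 (fun s => u s * fcos m s)).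
    { intros u; apply int1_ext; intros s; unfold fcos; rewrite opp_IZR, <- cos_neg.
      do 2 f_equal; ring. }
    assert (G' : forall u, cont1 u -> int1 (fun s => u s * fsin (- m) s) = - int1 (fun s => u s * fsin m s)).
    { intros u Hu; replace (- int1 (fun s => u s * fsin m s)) with (-1 * int1 (fun s => u s * fsin m s)) by ring.
      assert (D := cont1_fsin m).
      rewrite <- int1_scal by cont1.
      apply int1_ext; intros s; unfold fsin; rewrite opp_IZR.
      replace (2 * PI * - IZR m * s) with (- (2 * PI * IZR m * s)) by ring; rewrite sin_neg; ring. }
    destruct Hf as [Hu Hv].
    rewrite G, (G' (fun s => fst (f (line x s v)))) in F1 by exact (cont_n_line n _ x v Hu).
    rewrite G, (G' (fun s => snd (f (line x s v)))) in F2 by exact (cont_n_line n _ x v Hv).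
    cbv beta in *; lra. }
  destruct Hf as [Hu Hv].
  assert (A := cont_n_line n _ x v Hu); assert (B := cont_n_line n _ x v Hv).
  cbv beta in A, B.
  assert (E : f (line x 1 v) = f (line x 0 v)).
  { transitivity (f x); [apply Hper|f_equal; symmetry; apply line_0]. }
  apply Cx_eq; simpl.
  - transitivity (fst (f (line x 0 v))); [do 2 f_equal; symmetry; apply line_0|].
    exact (vanishing_coefs_at0 _ A (f_equal fst E) (fun m => proj1 (H m))).
  - transitivity (snd (f (line x 0 v))); [do 2 f_equal; symmetry; apply line_0|].
    exact (vanishing_coefs_at0 _ B (f_equal snd E) (fun m => proj2 (H m))).
Qed.

End FourierLine.

(** * Iterated projections along a lattice basis and the dual lattice *)

Module FourierTorus.
Import Coquelicot FourierLine Defs.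

(* The function (not the number) of frequency m: by [coef_mode] it is a multiple of one
   character.  Iterating one-dimensional projections avoids any use of Fubini. *)
Fixpoint coef (b : nat -> Pt) (m : nat -> Z) (j : nat) (f : Pt -> Cx) : Pt -> Cx :=
  match j with O => f | S l => proj (b l) (m l) (coef b m l f) end.

Definition lat_periodic (n : nat) (b : nat -> Pt) (f : Pt -> Cx) : Prop :=
  forall l x, (l < n)%nat -> f (line x 1 (b l)) = f x.

Lemma coef_cont n b m j f : ccont n f -> ccont n (coef b m j f).
Proof. intros Hf; induction j; simpl; [exact Hf|now apply proj_cont]. Qed.

Lemma coef_cpd n b m j i f g : ccont n f -> ccont n g -> cpd i f g ->
  cpd i (coef b m j f) (coef b m j g).
Proof.
  intros Hf Hg H; induction j; simpl; [exact H|].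
  apply (proj_cpd n); try apply coef_cont; assumption.
Qed.

Lemma coef_add n b m j f g : ccont n f -> ccont n g ->
  coef b m j (fun x => cadd (f x) (g x)) = fun x => cadd (coef b m j f x) (coef b m j g x).
Proof.
  intros Hf Hg; induction j as [|j IH]; simpl; [reflexivity|].
  rewrite IH; apply (proj_add n); now apply coef_cont.
Qed.

Lemma coef_mul n b m j c f : ccont n f ->
  coef b m j (fun x => cmul c (f x)) = fun x => cmul c (coef b m j f x).
Proof.
  intros Hf; induction j as [|j IH]; simpl; [reflexivity|].
  rewrite IH; apply (proj_mul n); now apply coef_cont.
Qed.

Lemma coef_0 (n : nat) b m j : coef b m j (fun _ => c0) = fun _ => c0.
Proof.
  replace (fun _ : Pt => c0) with (fun x : Pt => cmul c0 ((fun _ => c0) x)) at 1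
    by (apply functional_extensionality; intros; apply cmul0).
  rewrite (coef_mul n) by apply ccont_0.
  apply functional_extensionality; intros; apply cmul0.
Qed.

Lemma coef_ext b m m' j f : (forall l, (l < j)%nat -> m l = m' l) ->
  coef b m j f = coef b m' j f.
Proof.
  intros H; induction j as [|j IH]; simpl; [reflexivity|].
  rewrite IH by auto; now rewrite (H j) by lia.
Qed.

Lemma coef_equivar n b m j f w t e : ccont n f ->
  (forall x, f (line x t w) = cmul e (f x)) ->
  forall x, coef b m j f (line x t w) = cmul e (coef b m j f x).
Proof.
  intros Hf He; induction j as [|j IH]; simpl; [exact He|].
  intros x; apply (proj_equivar n); [now apply coef_cont|exact IH].
Qed.

Lemma coef_periodic n b m j f : ccont n f -> lat_periodic n b f -> lat_periodic n b (coef b m j f).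
Proof.
  intros Hf Hp l x Hl; rewrite (coef_equivar n b m j f (b l) 1 (1, 0)); [apply cmul1|exact Hf|].
  intros y; rewrite cmul1; now apply Hp.
Qed.

Lemma coef_char n b m j f l t : ccont n f -> lat_periodic n b f -> (l < j)%nat -> (j <= n)%nat ->
  forall x, coef b m j f (line x t (b l)) = cmul (cexp (IZR (m l) * t)) (coef b m j f x).
Proof.
  intros Hf Hp; revert l; induction j as [|j IH]; [lia|].
  intros l Hl Hj x; simpl; destruct (Nat.eq_dec l j) as [->|Hn].
  - apply (proj_char n); [now apply coef_cont|].
    intros y; apply (coef_periodic n); [exact Hf|exact Hp|lia].
  - apply (proj_equivar n); [now apply coef_cont|]. intros y; apply IH; lia.
Qed.

(** [proj_unique] is pointwise: as long as the value at this x is nonzero, some projection along the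
    next basis vector is nonzero at the same x. The frequency is thus built one entry at a time,
    entry j being overwritten by the new k. *)
Lemma coef_unique n b j f x : ccont n f -> lat_periodic n b f -> (j <= n)%nat ->
  f x <> c0 -> exists m, coef b m j f x <> c0.
Proof.
  intros Hf Hp; induction j as [|j IH]; intros Hj Hx; [now exists (fun _ => 0%Z)|].
  destruct IH as [m Hm]; [lia|exact Hx|].
  apply NNPP; intros HN; apply Hm; apply (proj_unique n (b j)).
  - now apply coef_cont.
  - intros y; apply (coef_periodic n); [exact Hf|exact Hp|lia].
  - intros k; apply NNPP; intros Hk; apply HN.
    exists (fun l => if Nat.eqb l j then k else m l); simpl.
    rewrite Nat.eqb_refl.
    rewrite (coef_ext b _ m); [exact Hk|].
    intros l Hl; destruct (Nat.eqb_spec l j); [lia|reflexivity].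
Qed.

(** The two clauses are the two one-sided inverse identities between the matrices of b and bs. The
    first reads the integers m j off [freq n bs m]; the second expands any point along b. *)
Definition dual_basis n (b bs : nat -> Pt) : Prop :=
  (forall i j, (i < n)%nat -> (j < n)%nat -> dot n (bs i) (b j) = if Nat.eqb i j then 1 else 0) /\
  (forall x i, (i < n)%nat -> x i = rsum n (fun j => dot n (bs j) x * b j i)).

Definition freq n (bs : nat -> Pt) (m : nat -> Z) : Pt :=
  fun i => rsum n (fun j => IZR (m j) * bs j i).

Lemma rsum_swap n k (f : nat -> nat -> R) :
  rsum n (fun i => rsum k (fun j => f i j)) = rsum k (fun j => rsum n (fun i => f i j)).
Proof.
  induction n as [|n IH]; simpl; [symmetry; apply rsum_0|].
  rewrite IH; symmetry; apply rsum_plus.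
Qed.

Lemma rsum_scal_r n c f : rsum n (fun i => f i * c) = rsum n f * c.
Proof. rewrite Rmult_comm, <- rsum_scal; apply rsum_ext; intros; ring. Qed.

Lemma dot_freq n bs m x : dot n (freq n bs m) x = rsum n (fun j => IZR (m j) * dot n (bs j) x).
Proof.
  unfold dot, freq.
  transitivity (rsum n (fun i => rsum n (fun j => IZR (m j) * bs j i * x i))).
  { apply rsum_ext; intros; now rewrite rsum_scal_r. }
  rewrite rsum_swap; apply rsum_ext; intros j _; rewrite <- rsum_scal; apply rsum_ext; intros; ring.
Qed.

Lemma rsum_pick n j (f : nat -> R) : (j < n)%nat ->
  rsum n (fun i => if Nat.eqb i j then f i else 0) = f j.
Proof.
  induction n as [|n IH]; [lia|]; intros Hj; simpl.
  destruct (Nat.eqb_spec n j) as [->|Hn].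
  - rewrite (rsum_ext _ _ (fun _ => 0)), rsum_0; [ring|].
    intros i Hi; destruct (Nat.eqb_spec i j); [lia|reflexivity].
  - rewrite IH by lia; ring.
Qed.

Lemma dot_freq_basis n b bs m j : dual_basis n b bs -> (j < n)%nat ->
  dot n (freq n bs m) (b j) = IZR (m j).
Proof.
  intros [H _] Hj; rewrite dot_freq.
  rewrite (rsum_ext n _ (fun i => if Nat.eqb i j then IZR (m i) else 0)).
  - now apply rsum_pick.
  - intros i Hi; rewrite H by assumption; destruct (Nat.eqb i j); ring.
Qed.

Lemma dual_freq n b bs m : dual_basis n b bs -> dual_mem n b (freq n bs m).
Proof.
  intros Hb v [k Hk].
  assert (E : dot n (freq n bs m) v = rsum n (fun j => IZR (m j * k j))).
  { unfold dot; rewrite (rsum_ext n _ (fun i => rsum n (fun j => freq n bs m i * (IZR (k j) * b j i)))).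
    2:{ intros i Hi; rewrite Hk by exact Hi; now rewrite rsum_scal. }
    rewrite rsum_swap; apply rsum_ext; intros j Hj.
    rewrite mult_IZR, <- (dot_freq_basis n b bs m j Hb Hj), Rmult_comm; unfold dot.
    rewrite <- rsum_scal; apply rsum_ext; intros; ring. }
  rewrite E; clear; induction n as [|n [z IH]]; simpl; [now exists 0%Z|].
  rewrite IH, <- plus_IZR; eauto.
Qed.

Lemma basis_in_lattice n b j : (j < n)%nat -> lattice_mem n b (b j).
Proof.
  intros Hj; exists (fun l => if Nat.eqb l j then 1%Z else 0%Z); intros i Hi.
  rewrite (rsum_ext n _ (fun l => if Nat.eqb l j then b l i else 0)).
  - symmetry; exact (rsum_pick n j (fun l => b l i) Hj).
  - intros l _; destruct (Nat.eqb l j); simpl; ring.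
Qed.

(** The integers are the pairings of mu with the basis vectors. Expanding the i-th unit vector along
    b recovers the i-th coordinate of mu from them. *)
Lemma dual_mem_freq n b bs mu : dual_basis n b bs -> dual_mem n b mu ->
  exists m, forall i, (i < n)%nat -> mu i = freq n bs m i.
Proof.
  intros Hb Hmu.
  assert (H : forall j, exists z, (j < n)%nat -> dot n mu (b j) = IZR z).
  { intros j; destruct (lt_dec j n) as [Hj|Hj].
    - destruct (Hmu (b j) (basis_in_lattice n b j Hj)) as [z Hz]; now exists z.
    - exists 0%Z; intros; contradiction. }
  destruct (functional_choice _ H) as [m Hm]; exists m; intros i Hi.
  destruct Hb as [_ H2].
  set (e := fun l => if Nat.eqb l i then 1 else 0).
  assert (De : forall u, dot n u e = u i).
  { intros u; unfold dot, e; rewrite (rsum_ext n _ (fun l => if Nat.eqb l i then u l else 0)).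
    - now apply rsum_pick.
    - intros l _; destruct (Nat.eqb l i); ring. }
  rewrite <- (De mu); unfold dot at 1.
  rewrite (rsum_ext n _ (fun l => rsum n (fun j => bs j i * (mu l * b j l)))).
  - rewrite rsum_swap; unfold freq; apply rsum_ext; intros j Hj.
    rewrite <- Hm by exact Hj; rewrite rsum_scal; unfold dot; ring.
  - intros l Hl; rewrite (H2 e l Hl), <- rsum_scal; apply rsum_ext; intros j Hj.
    rewrite De; ring.
Qed.

(* A function that is equivariant along every b_l is a multiple of a character. *)
Lemma coef_mode n b bs m f : dual_basis n b bs -> ccont n f -> lat_periodic n b f ->
  coef b m n f = fun x => cmul (coef b m n f (fun _ => 0)) (cexp (dot n (freq n bs m) x)).
Proof.
  intros Hb Hf Hp; apply functional_extensionality; intros x.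
  (* The point x is reached from the origin in n legs, the l-th one along b_l of length <bs_l, x>,
     and each leg multiplies the value by its own character. *)
  assert (P : forall j, (j <= n)%nat ->
    coef b m n f (fun i => rsum j (fun l => dot n (bs l) x * b l i)) =
    cmul (cexp (rsum j (fun l => IZR (m l) * dot n (bs l) x))) (coef b m n f (fun _ => 0))).
  { induction j as [|j IH]; intros Hj; simpl.
    - now rewrite cexp_0, cmul1.
    - change (fun i => rsum j (fun l => dot n (bs l) x * b l i) + dot n (bs j) x * b j i)
        with (line (fun i => rsum j (fun l => dot n (bs l) x * b l i)) (dot n (bs j) x) (b j)).
      rewrite (coef_char n) by (assumption || lia).
      rewrite IH, cmulA by lia; f_equal; rewrite <- cexp_add; f_equal; ring. }
  specialize (P n (le_n n)).
  rewrite dot_freq, cmulC, <- P.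
  assert (C := coef_cont n b m n f Hf); destruct C as [C1 C2].
  apply Cx_eq; [apply (cont_n_ext n _ _ _ C1)|apply (cont_n_ext n _ _ _ C2)];
    intros i Hi; now apply Hb.
Qed.

(** * Single Fourier modes: orthogonality, smoothness, periodicity *)

Definition mode n (mu : Pt) (c : Cx) : Pt -> Cx := fun x => cmul c (cexp (dot n mu x)).

Lemma dot_line n mu x s v : dot n mu (line x s v) = dot n mu x + s * dot n mu v.
Proof.
  unfold dot, line; rewrite <- rsum_scal, <- rsum_plus; apply rsum_ext; intros; ring.
Qed.

(** Orthogonality of characters: along v the mode oscillates as exp (2 i pi k s), so the projection
    integrates exp (2 i pi (k - m) s) over a period. *)
Lemma proj_mode n v m k mu c : dot n mu v = IZR k ->
  proj v m (mode n mu c) = if Z.eqb k m then mode n mu c else fun _ => c0.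
Proof.
  intros Hk; apply functional_extensionality; intros x.
  set (z := mode n mu c x).
  assert (E : forall s, cmul (mode n mu c (line x s v)) (cexp (- (IZR m * s))) =
     cmul z (fcos (k - m) s, fsin (k - m) s)).
  { intros s; unfold z, mode; rewrite dot_line, Hk, <- !cmulA, <- cexp_add; f_equal.
    replace (dot n mu x + s * IZR k + - (IZR m * s)) with (dot n mu x + IZR (k - m) * s)
      by (rewrite minus_IZR; ring).
    rewrite cexp_add; f_equal; unfold cexp, fcos, fsin; f_equal; f_equal; ring. }
  assert (C := cont1_fcos (k - m)); assert (D := cont1_fsin (k - m)).
  transitivity (cmul z (int1 (fcos (k - m)), int1 (fsin (k - m)))).
  - apply Cx_eq.
    + change (int1 (fun s => fst (cmul (mode n mu c (line x s v)) (cexp (- (IZR m * s))))) =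
        fst z * int1 (fcos (k - m)) - snd z * int1 (fsin (k - m))).
      rewrite <- !int1_scal, <- int1_minus by cont1.
      apply int1_ext; intros s; now rewrite E.
    + change (int1 (fun s => snd (cmul (mode n mu c (line x s v)) (cexp (- (IZR m * s))))) =
        fst z * int1 (fsin (k - m)) + snd z * int1 (fcos (k - m))).
      rewrite <- !int1_scal, <- int1_plus by cont1.
      apply int1_ext; intros s; now rewrite E.
  - unfold fcos, fsin; rewrite int1_cos, int1_sin.
    destruct (Z.eqb_spec k m) as [->|Hn].
    + rewrite Z.sub_diag; apply cmulr1.
    + destruct (Z.eqb_spec (k - m) 0); [lia|apply cmulr0].
Qed.

Lemma coef_mode_same n b bs m j c : dual_basis n b bs -> (j <= n)%nat ->
  coef b m j (mode n (freq n bs m) c) = mode n (freq n bs m) c.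
Proof.
  intros Hb; induction j as [|j IH]; intros Hj; simpl; [reflexivity|].
  rewrite IH, (proj_mode n _ _ (m j)) by (try lia; now apply (dot_freq_basis n b)).
  now rewrite Z.eqb_refl.
Qed.

(** Each projection either fixes the mode or kills it, and once killed it stays 0. A single
    direction l in which the frequencies differ is enough. *)
Lemma coef_mode_diff n b bs m k j l c : dual_basis n b bs -> (l < j)%nat -> (j <= n)%nat ->
  m l <> k l -> coef b m j (mode n (freq n bs k) c) = fun _ => c0.
Proof.
  intros Hb Hl Hj Hn.
  assert (D : forall i, (i <= n)%nat -> coef b m i (mode n (freq n bs k) c) = mode n (freq n bs k) c
     \/ coef b m i (mode n (freq n bs k) c) = fun _ => c0).
  { induction i as [|i IH]; intros Hi; simpl; [now left|].
    destruct IH as [IH|IH]; [lia| |]; rewrite IH.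
    - rewrite (proj_mode n _ _ (k i)) by now apply (dot_freq_basis n b).
      destruct (Z.eqb (k i) (m i)); auto.
    (* One iteration of [coef] with constant data is the projection along [b i], so [coef_0] also
       says that a single projection of 0 is 0. *)
    - right; apply (coef_0 n (fun _ => b i) (fun _ => m i) 1). }
  induction j as [|j IH]; [lia|]; simpl.
  destruct (Nat.eq_dec l j) as [->|Hlj].
  - destruct (D j) as [E|E]; [lia| |]; rewrite E.
    + rewrite (proj_mode n _ _ (k j)) by now apply (dot_freq_basis n b).
      destruct (Z.eqb_spec (k j) (m j)); [congruence|reflexivity].
    + apply (coef_0 n (fun _ => b j) (fun _ => m j) 1).
  - rewrite IH by lia; apply (coef_0 n (fun _ => b j) (fun _ => m j) 1).
Qed.

(** A two-parameter family that contains the real and imaginary parts of a mode and is closed under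
    partial derivatives, so smoothness is an induction over the list of directions. *)
Definition trig n (mu : Pt) (A B : R) (x : Pt) : R :=
  A * cos (2 * PI * dot n mu x) + B * sin (2 * PI * dot n mu x).

Lemma dot_shift n mu x i t : (i < n)%nat -> dot n mu (shift x i t) = dot n mu x + mu i * t.
Proof.
  intros Hi; unfold dot, shift.
  rewrite <- (rsum_pick n i (fun l => mu l * t) Hi), <- rsum_plus.
  apply rsum_ext; intros j _; destruct (Nat.eqb j i); ring.
Qed.

Lemma trig_pd n mu A B i : (i < n)%nat ->
  pd i (trig n mu A B) (trig n mu (2 * PI * mu i * B) (- (2 * PI * mu i * A))).
Proof.
  intros Hi x; apply is_derive_Reals.
  apply is_derive_ext with (fun t => A * cos (2 * PI * (dot n mu x + mu i * t)) + B * sin (2 * PI * (dot n mu x + mu i * t))).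
  - intros t; unfold trig; now rewrite dot_shift.
  - unfold trig; auto_derive; [exact I|].
    rewrite Rmult_0_r, Rplus_0_r; ring.
Qed.

Lemma dot_cont n mu : cont_n n (dot n mu).
Proof.
  intros x eps He; set (S := rsum n (fun i => Rabs (mu i)) + 1).
  assert (Hpos : forall k, 0 <= rsum k (fun i => Rabs (mu i))).
  { induction k; simpl; [lra|generalize (Rabs_pos (mu k)); lra]. }
  assert (HS : 0 < S) by (unfold S; generalize (Hpos n); lra).
  exists (eps / S); split; [now apply Rdiv_lt_0_compat|]; intros y Hy.
  assert (HeS : 0 < eps / S) by now apply Rdiv_lt_0_compat.
  apply Rle_lt_trans with (rsum n (fun i => Rabs (mu i)) * (eps / S)).
  - assert (G : forall k, (k <= n)%nat -> Rabs (dot k mu y - dot k mu x) <= rsum k (fun i => Rabs (mu i)) * (eps / S)).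
    { induction k as [|k IH]; intros Hk; unfold dot; simpl.
      - rewrite Rminus_diag, Rabs_R0; lra.
      - specialize (IH ltac:(lia)); unfold dot in IH.
        match goal with |- Rabs (?a + ?b - (?c + ?d)) <= _ =>
          replace (a + b - (c + d)) with ((a - c) + mu k * (y k - x k)) by ring end.
        eapply Rle_trans; [apply Rabs_triang|]; rewrite Rabs_mult, Rmult_plus_distr_r.
        specialize (Hy k ltac:(lia)).
        apply Rplus_le_compat; [exact IH|apply Rmult_le_compat_l; [apply Rabs_pos|lra]]. }
    apply G; lia.
  - replace eps with (S * (eps / S)) at 2 by (field; lra).
    apply Rmult_lt_compat_r; [exact HeS|unfold S; lra].
Qed.

Lemma cont1_comp n h g : cont1 h -> cont_n n g -> cont_n n (fun x => h (g x)).
Proof.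
  intros Hh Hg x eps He.
  destruct (cont1_eps_inv h Hh (g x) eps He) as [d [Hd H]].
  destruct (Hg x d Hd) as [d' [Hd' H']].
  exists d'; split; [exact Hd'|]; intros y Hy; apply H, H', Hy.
Qed.

Lemma trig_cont n mu A B : cont_n n (trig n mu A B).
Proof.
  apply (cont1_comp n (fun t => A * cos (2 * PI * t) + B * sin (2 * PI * t))); [cont1|].
  apply dot_cont.
Qed.

Lemma trig_smooth n mu A B : smooth_n n (trig n mu A B).
Proof.
  intros ds Hds.
  assert (H : exists A' B', iter_pd (trig n mu A B) ds (trig n mu A' B')).
  { induction ds as [|i ds IH]; simpl; [now exists A, B|].
    inversion Hds; subst; destruct IH as [A' [B' IH]]; [assumption|].
    do 2 eexists; exists (trig n mu A' B'); split; [exact IH|now apply trig_pd]. }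
  destruct H as [A' [B' H]]; exists (trig n mu A' B'); split; [exact H|apply trig_cont].
Qed.

Lemma mode_trig n mu c : (fun x => fst (mode n mu c x)) = trig n mu (fst c) (- snd c) /\
  (fun x => snd (mode n mu c x)) = trig n mu (snd c) (fst c).
Proof.
  split; apply functional_extensionality; intros x; unfold mode, trig, cmul, cexp; simpl; ring.
Qed.

Lemma mode_cont n mu c : ccont n (mode n mu c).
Proof. destruct (mode_trig n mu c) as [E1 E2]; split; rewrite ?E1, ?E2; apply trig_cont. Qed.

Lemma mode_cpd n mu c i : (i < n)%nat ->
  cpd i (mode n mu c) (mode n mu (cmul (0, 2 * PI * mu i) c)).
Proof.
  intros Hi; destruct (mode_trig n mu c) as [E1 E2].
  destruct (mode_trig n mu (cmul (0, 2 * PI * mu i) c)) as [E3 E4].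
  split; rewrite ?E1, ?E2, ?E3, ?E4.
  - replace (trig n mu (fst (cmul (0, 2 * PI * mu i) c)) (- snd (cmul (0, 2 * PI * mu i) c)))
      with (trig n mu (2 * PI * mu i * - snd c) (- (2 * PI * mu i * fst c))); [now apply trig_pd|].
    unfold cmul; simpl; f_equal; ring.
  - replace (trig n mu (snd (cmul (0, 2 * PI * mu i) c)) (fst (cmul (0, 2 * PI * mu i) c)))
      with (trig n mu (2 * PI * mu i * fst c) (- (2 * PI * mu i * snd c))); [now apply trig_pd|].
    unfold cmul; simpl; f_equal; ring.
Qed.

Lemma cpd_unique i f g g' : cpd i f g -> cpd i f g' -> g = g'.
Proof.
  intros [A B] [A' B']; apply functional_extensionality; intros x; apply Cx_eq;
    eapply uniqueness_limite; [apply (A x)|apply (A' x)|apply (B x)|apply (B' x)].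
Qed.

Lemma mode_0 n mu c : mode n mu c (fun _ => 0) = c.
Proof.
  unfold mode, dot; rewrite (rsum_ext n _ (fun _ => 0)) by (intros; ring).
  rewrite rsum_0, cexp_0; apply cmulr1.
Qed.

Lemma dot_ext n mu x y : (forall i, (i < n)%nat -> x i = y i) -> dot n mu x = dot n mu y.
Proof. intros H; apply rsum_ext; intros i Hi; now rewrite H. Qed.

Lemma mode_periodic n b mu c v x : dual_mem n b mu -> lattice_mem n b v ->
  mode n mu c (fun i => x i + v i) = mode n mu c x.
Proof.
  intros Hmu Hv; destruct (Hmu v Hv) as [z Hz]; unfold mode; f_equal.
  replace (dot n mu (fun i => x i + v i)) with (dot n mu x + IZR z).
  - now rewrite cexp_add, cexp_Z, cmulr1.
  - rewrite <- Hz; unfold dot; rewrite <- rsum_plus; apply rsum_ext; intros; ring.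
Qed.

End FourierTorus.

(** * The symbol of the curl and the amplitudes of an eigenform *)

Module Eigenforms.
Import Coquelicot List ListNotations FourierLine FourierTorus Defs.

Definition csum {A} (l : list A) (f : A -> Cx) : Cx := fold_right cadd c0 (map f l).

Lemma csum_ext {A} (l : list A) f g : (forall a, In a l -> f a = g a) -> csum l f = csum l g.
Proof.
  intros H; unfold csum; induction l as [|a l IH]; simpl; [reflexivity|].
  rewrite H by (simpl; auto); rewrite IH; [reflexivity|]. intros; apply H; simpl; auto.
Qed.

Lemma csum_mulr {A} (l : list A) f c : csum l (fun a => cmul (f a) c) = cmul (csum l f) c.
Proof.
  unfold csum; induction l as [|a l IH]; simpl; [now rewrite cmul0|].
  now rewrite IH, cmulDl.
Qed.

Lemma csum_ccont {A} n (l : list A) (f : A -> Pt -> Cx) : (forall a, In a l -> ccont n (f a)) ->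
  ccont n (fun x => csum l (fun a => f a x)).
Proof.
  unfold csum; induction l as [|a l IH]; intros H; simpl; [apply ccont_0|].
  apply (ccont_add n (f a)); [apply H; simpl; auto|apply IH; intros; apply H; simpl; auto].
Qed.

Lemma coef_csum {A} n b m j (l : list A) (f : A -> Pt -> Cx) : (forall a, In a l -> ccont n (f a)) ->
  coef b m j (fun x => csum l (fun a => f a x)) = fun x => csum l (fun a => coef b m j (f a) x).
Proof.
  induction l as [|a l IH]; intros H; [apply (coef_0 n)|].
  assert (Ha : ccont n (f a)) by (apply H; simpl; auto).
  assert (Hl : forall a, In a l -> ccont n (f a)) by (intros; apply H; simpl; auto).
  etransitivity; [exact (coef_add n b m j (f a) _ Ha (csum_ccont n l f Hl))|].
  now rewrite IH.
Qed.

(** Collects the possible factor i, the sign of the Hodge star and the alternating sign of the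
    exterior derivative. The curl becomes a finite sum of constant multiples of partial derivatives,
    to which linearity of [coef] applies. *)
Definition curl_weight n (I : list nat) (a : nat) : Cx :=
  cmul (if Nat.eqb (Nat.modulo n 4) 1 then (0, 1) else (1, 0))
    (cmul (sgn (ninv (compl n I) I), 0) (sgn a, 0)).

Lemma curl_at_csum n P I x : curl_at n P I x =
  csum (seq 0 (length (compl n I))) (fun a => cmul (curl_weight n I a)
    (P (nth a (compl n I) O) (remove_nth a (compl n I)) x)).
Proof.
  set (J := compl n I).
  assert (E : forall c l, csum l (fun a => cmul (cmul c (sgn a, 0)) (P (nth a J O) (remove_nth a J) x))
    = cmul c (fold_right cadd c0 (map (fun a => cscal (sgn a) (P (nth a J O) (remove_nth a J) x)) l))).
  { intros c l; unfold csum; induction l as [|a l IH]; simpl; [now rewrite cmulr0|].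
    now rewrite IH, cmulDr, cscalE, cmulA. }
  unfold curl_at, dform_at, curl_weight; fold J; set (s := sgn (ninv J I)).
  rewrite (csum_ext _ _ (fun a => cmul (cmul (cmul (if Nat.eqb (Nat.modulo n 4) 1 then (0, 1) else (1, 0)) (s, 0))
     (sgn a, 0)) (P (nth a J O) (remove_nth a J) x))) by (intros; now rewrite !cmulA).
  rewrite E; destruct (Nat.eqb (n mod 4) 1); rewrite ?cIE, cscalE, ?cmulA, ?cmul1; reflexivity.
Qed.

(** The curl formula itself, with the i-th partial derivative replaced by multiplication by 2 i pi
    mu_i. The integrand is constant in the point, so the evaluation point is arbitrary. *)
Definition symbol n (mu : Pt) (a : list nat -> Cx) (I : list nat) : Cx :=
  curl_at n (fun i J _ => cmul (0, 2 * PI * mu i) (a J)) I (fun _ => 0).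

Definition symbol_eig n (mu : Pt) (lam : R) (a : list nat -> Cx) : Prop :=
  let k := Nat.div (n - 1) 2 in
  (forall I, ~ valid_idx n k I -> a I = c0) /\
  (forall I, valid_idx n k I -> symbol n mu a I = cscal lam (a I)).

Definition mode_form n (mu : Pt) (a : list nat -> Cx) : Form := fun I => mode n mu (a I).

(* The components of a form that enter its curl are among those of [curl_eq]. *)
Definition faces_valid n : Prop := let k := Nat.div (n - 1) 2 in
  forall I, valid_idx n k I -> forall a, (a < length (compl n I))%nat ->
    (nth a (compl n I) O < n)%nat /\ valid_idx n k (remove_nth a (compl n I)).

Lemma curl_mode n mu a I x :
  curl_at n (fun i J => mode n mu (cmul (0, 2 * PI * mu i) (a J))) I x =
  cmul (symbol n mu a I) (cexp (dot n mu x)).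
Proof.
  unfold symbol; rewrite !curl_at_csum, <- csum_mulr.
  apply csum_ext; intros j _; unfold mode; now rewrite !cmulA.
Qed.

Lemma mode_form_eigen n b mu lam a : dual_mem n b mu -> symbol_eig n mu lam a ->
  eigensp n b lam (mode_form n mu a).
Proof.
  intros Hmu [H0 Ha]; split; [split|].
  - intros I x HI; unfold mode_form, mode; rewrite (H0 I HI); apply cmul0.
  - intros I HI; destruct (mode_trig n mu (a I)) as [E1 E2]; repeat split.
    + unfold mode_form; rewrite E1; apply trig_smooth.
    + unfold mode_form; rewrite E2; apply trig_smooth.
    + intros x y Hxy; unfold mode_form, mode; now rewrite (dot_ext n mu x y).
    + intros v x Hv; now apply (mode_periodic n b).
  - exists (fun i I => mode n mu (cmul (0, 2 * PI * mu i) (a I))); split.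
    + intros i I Hi HI; exact (mode_cpd n mu (a I) i Hi).
    + intros I x HI; rewrite curl_mode, Ha by exact HI.
      unfold mode_form, mode; rewrite !cscalE; now rewrite cmulA.
Qed.

Lemma lattice_line_periodic n b (f : Pt -> Cx) :
  (forall x y, (forall i, (i < n)%nat -> x i = y i) -> f x = f y) ->
  (forall v x, lattice_mem n b v -> f (fun i => x i + v i) = f x) -> lat_periodic n b f.
Proof.
  intros He Hp l x Hl; rewrite <- (Hp (b l) x (basis_in_lattice n b l Hl)).
  apply He; intros i _; unfold line; ring.
Qed.

Lemma iter_pd_nil_cont n f : smooth_n n f -> cont_n n f.
Proof.
  intros H; destruct (H nil (Forall_nil _)) as [g [Hg Hc]]; simpl in Hg.
  replace f with g; [exact Hc|apply functional_extensionality, Hg].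
Qed.

(** [curl_eq] provides some first derivatives without regularity, [smooth_n] some continuous ones;
    uniqueness of derivatives identifies them. *)
Lemma pd_smooth_cont n i f g : (i < n)%nat -> smooth_n n f -> pd i f g -> cont_n n g.
Proof.
  intros Hi H Hg; destruct (H (i :: nil)) as [g' [[h [Hh Hg']] Hc]]; [auto|].
  replace g with g'; [exact Hc|]; apply functional_extensionality; intros x.
  replace h with f in Hg' by (symmetry; apply functional_extensionality, Hh).
  eapply uniqueness_limite; [apply Hg'|apply Hg].
Qed.

Lemma admissible_comp n b w I : admissible n b w -> ccont n (w I) /\ lat_periodic n b (w I).
Proof.
  intros [H0 H]; destruct (classic (valid_idx n (Nat.div (n - 1) 2) I)) as [HI|HI].
  - destruct (H I HI) as [S1 [S2 [He Hp]]]; split.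
    + split; now apply iter_pd_nil_cont.
    + now apply lattice_line_periodic.
  - replace (w I) with (fun _ : Pt => c0)
      by (symmetry; apply functional_extensionality; intros; now apply H0).
    split; [apply ccont_0|intros l x Hl; reflexivity].
Qed.

(** The projected component is a constant times a character, and the character is 1 at the origin,
    so evaluation there gives the Fourier coefficient. *)
Definition amp n b (w : Form) (m : nat -> Z) : list nat -> Cx :=
  fun I => coef b m n (w I) (fun _ => 0).

Lemma amp_mode n b bs w m I : dual_basis n b bs -> admissible n b w ->
  coef b m n (w I) = mode n (freq n bs m) (amp n b w m I).
Proof.
  intros Hb Hw; destruct (admissible_comp n b w I Hw) as [Hc Hp].
  now apply coef_mode.
Qed.

(* The projections commute with partial derivatives, hence turn the curl equation into
   an algebraic one. *)
Lemma amp_eig n b bs lam w m : dual_basis n b bs -> faces_valid n -> eigensp n b lam w ->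
  symbol_eig n (freq n bs m) lam (amp n b w m).
Proof.
  intros Hb Hf [Hw [P [HP Heq]]]; split.
  - intros I HI; unfold amp.
    replace (w I) with (fun _ : Pt => c0)
      by (symmetry; apply functional_extensionality; intros; now apply Hw).
    now rewrite (coef_0 n).
  - intros I HI; set (mu := freq n bs m).
    assert (CP : forall i J, (i < n)%nat -> valid_idx n (Nat.div (n - 1) 2) J ->
       ccont n (P i J) /\ coef b m n (P i J) = mode n mu (cmul (0, 2 * PI * mu i) (amp n b w m J))).
    { intros i J Hi HJ; destruct (HP i J Hi HJ) as [P1 P2].
      destruct Hw as [Hw0 Hw]; destruct (Hw J HJ) as [S1 [S2 _]].
      assert (Cc : ccont n (P i J)) by (split; [exact (pd_smooth_cont n i _ _ Hi S1 P1)|exact (pd_smooth_cont n i _ _ Hi S2 P2)]).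
      split; [exact Cc|].
      destruct (admissible_comp n b w J (conj Hw0 Hw)) as [Cw _].
      apply (cpd_unique i (coef b m n (w J))).
      - apply (coef_cpd n); [exact Cw|exact Cc|split; assumption].
      - rewrite (amp_mode n b bs w m J Hb (conj Hw0 Hw)); now apply mode_cpd. }
    assert (E : coef b m n (fun x => curl_at n P I x) = fun x => cmul (lam, 0) (coef b m n (w I) x)).
    { rewrite <- (coef_mul n) by apply (admissible_comp n b w I Hw); f_equal.
      apply functional_extensionality; intros x; rewrite Heq by exact HI; apply cscalE. }
    apply (f_equal (fun h => h (fun _ => 0))) in E; fold (amp n b w m I) in E.
    rewrite cscalE; etransitivity; [|exact E]; clear E.
    replace (fun x => curl_at n P I x) with (fun x =>
      csum (seq 0 (length (compl n I))) (fun a => cmul (curl_weight n I a)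
        (P (nth a (compl n I) O) (remove_nth a (compl n I)) x)))
      by (apply functional_extensionality; intros; now rewrite curl_at_csum).
    assert (V : forall a, In a (seq 0 (length (compl n I))) ->
      (nth a (compl n I) O < n)%nat /\ valid_idx n (Nat.div (n - 1) 2) (remove_nth a (compl n I))).
    { intros a Ha; apply in_seq in Ha; apply Hf; [exact HI|lia]. }
    rewrite (coef_csum n b m n _ (fun a x => cmul (curl_weight n I a)
        (P (nth a (compl n I) O) (remove_nth a (compl n I)) x))).
    2:{ intros a Ha; apply ccont_mul; now apply CP; apply V. }
    unfold symbol; rewrite curl_at_csum; apply csum_ext; intros a Ha.
    destruct (V a Ha) as [V1 V2]; destruct (CP _ _ V1 V2) as [C1 C2].
    rewrite (coef_mul n) by exact C1; rewrite C2, mode_0; reflexivity.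
Qed.

(** Frequencies are functions on all of nat, of which only the first n entries count; this is the
    equality that matters, and [distinct] is freedom from duplicates with respect to it. *)
Definition agree n (m m' : nat -> Z) : Prop := forall l, (l < n)%nat -> m l = m' l.

Lemma agree_freq n bs m m' : agree n m m' -> freq n bs m = freq n bs m'.
Proof.
  intros H; apply functional_extensionality; intros i; apply rsum_ext; intros j Hj; now rewrite H.
Qed.

Inductive distinct n : list (nat -> Z) -> Prop :=
| distinct_nil : distinct n nil
| distinct_cons m l : (forall m', In m' l -> ~ agree n m m') -> distinct n l -> distinct n (m :: l).

Lemma not_agree n m m' : ~ agree n m m' -> exists l, (l < n)%nat /\ m l <> m' l.
Proof.
  intros H; apply NNPP; intros HN; apply H; intros l Hl; apply NNPP; intros E; apply HN; eauto.
Qed.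

Lemma coef_modes_miss n b bs m ms c : dual_basis n b bs ->
  (forall m', In m' ms -> ~ agree n m m') ->
  coef b m n (fun x => csum ms (fun m' => mode n (freq n bs m') (c m') x)) = fun _ => c0.
Proof.
  intros Hb H; rewrite (coef_csum n b m n ms (fun m' => mode n (freq n bs m') (c m')))
    by (intros; apply mode_cont).
  apply functional_extensionality; intros x.
  rewrite (csum_ext _ _ (fun _ => c0)).
  - unfold csum; induction ms as [|m' ms IH]; simpl; [reflexivity|].
    rewrite IH; [apply caddr0|intros; apply H; simpl; auto].
  - intros m' Hm'; destruct (not_agree n m m' (H m' Hm')) as [l [Hl Hne]].
    now rewrite (coef_mode_diff n b bs m m' n l (c m') Hb Hl (le_n n) Hne).
Qed.

Lemma coef_modes_hit n b bs m ms c : dual_basis n b bs -> distinct n ms -> In m ms ->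
  coef b m n (fun x => csum ms (fun m' => mode n (freq n bs m') (c m') x)) = mode n (freq n bs m) (c m).
Proof.
  intros Hb Hd; induction Hd as [|m0 ms Hm0 Hd IH]; simpl; [easy|].
  intros Hin.
  etransitivity.
  { apply (coef_add n b m n (mode n (freq n bs m0) (c m0))
     (fun x => csum ms (fun m' => mode n (freq n bs m') (c m') x))); [apply mode_cont|].
    apply (csum_ccont n ms (fun m' => mode n (freq n bs m') (c m'))); intros; apply mode_cont. }
  apply functional_extensionality; intros x.
  destruct Hin as [->|Hin].
  - rewrite (coef_mode_same n b) by (assumption || lia).
    rewrite (coef_modes_miss n b) by assumption; apply caddr0.
  - rewrite IH by exact Hin.
    assert (Hne : ~ agree n m m0).
    { intros E; apply (Hm0 m Hin); intros l Hl; symmetry; now apply E. }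
    destruct (not_agree n m m0 Hne) as [l [Hl Hne']].
    rewrite (coef_mode_diff n b bs m m0 n l _ Hb Hl (le_n n) Hne'); apply cadd0.
Qed.

Lemma mode_lat_periodic n b mu c : dual_mem n b mu -> lat_periodic n b (mode n mu c).
Proof.
  intros Hmu; apply lattice_line_periodic.
  - intros x y Hxy; unfold mode; now rewrite (dot_ext n mu x y).
  - intros v x Hv; now apply (mode_periodic n b).
Qed.

(** The difference between a component of w and the finite sum is continuous and periodic, and all
    its projections vanish: at a listed frequency the two modes cancel, elsewhere both are 0. Hence
    it is 0 by [coef_unique]. *)
Lemma eigenform_expansion n b bs lam w ms : dual_basis n b bs -> eigensp n b lam w ->
  distinct n ms ->
  (forall m I, amp n b w m I <> c0 -> exists m', In m' ms /\ agree n m m') ->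
  forall I x, w I x = csum ms (fun m => mode_form n (freq n bs m) (amp n b w m) I x).
Proof.
  intros Hb [Hw _] Hd Hms I x.
  destruct (admissible_comp n b w I Hw) as [Cw Pw].
  set (S := fun x => csum ms (fun m => mode n (freq n bs m) (amp n b w m I) x)).
  assert (CS : ccont n S).
  { apply (csum_ccont n ms (fun m => mode n (freq n bs m) (amp n b w m I))); intros; apply mode_cont. }
  assert (PS : lat_periodic n b S).
  { intros l y Hl; apply csum_ext; intros m _.
    apply (mode_lat_periodic n b); [now apply dual_freq|exact Hl]. }
  change (w I x = S x).
  set (f := fun x => cadd (w I x) (cmul (-1, 0) (S x))).
  assert (Cf : ccont n f) by (apply ccont_add; [exact Cw|now apply ccont_mul]).
  assert (Pf : lat_periodic n b f).
  { intros l y Hl; unfold f; now rewrite (Pw l y Hl), (PS l y Hl). }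
  assert (H0 : f x = c0).
  { apply NNPP; intros Hx.
    destruct (coef_unique n b n f x Cf Pf (le_n n) Hx) as [m Hm]; apply Hm.
    unfold f; rewrite (coef_add n b m n (w I) (fun x => cmul (-1, 0) (S x))) by (auto using ccont_mul).
    rewrite (coef_mul n) by exact CS.
    destruct (classic (exists m', In m' ms /\ agree n m m')) as [[m' [Hin Ha]]|Hno].
    - rewrite !(coef_ext b m m' n) by exact Ha.
      unfold S; rewrite (coef_modes_hit n b bs m' ms (fun m => amp n b w m I)) by assumption.
      rewrite (amp_mode n b bs) by assumption.
      apply Cx_eq; unfold cadd, cmul, c0; simpl; ring.
    - unfold S; rewrite (coef_modes_miss n b bs m ms (fun m => amp n b w m I)).
      2: exact Hb. 2:{ intros m' Hin Ha; apply Hno; eauto. }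
      rewrite (amp_mode n b bs) by assumption.
      assert (E : amp n b w m I = c0).
      { apply NNPP; intros HN; apply Hno, (Hms m I HN). }
      rewrite E; unfold mode; rewrite cmul0, cmulr0; apply caddr0. }
  unfold f in H0; destruct (w I x) as [u v], (S x) as [u' v'].
  unfold cadd, cmul, c0 in H0; simpl in H0; injection H0; intros; apply Cx_eq; simpl; lra.
Qed.

(** * From bases at each frequency to a basis of the eigenspace *)

Definition lincombv (cs : list Cx) (vs : list (list nat -> Cx)) (I : list nat) : Cx :=
  fold_right cadd c0 (map (fun p => cmul (fst p) (snd p I)) (combine cs vs)).

Definition vbasis (E : (list nat -> Cx) -> Prop) (vs : list (list nat -> Cx)) : Prop :=
  Forall E vs /\
  (forall cs, length cs = length vs -> (forall I, lincombv cs vs I = c0) -> Forall (fun c => c = c0) cs) /\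
  (forall a, E a -> exists cs, length cs = length vs /\ forall I, a I = lincombv cs vs I).

Lemma lincomb_app cs1 cs2 ws1 ws2 I x : length cs1 = length ws1 ->
  lincomb (cs1 ++ cs2) (ws1 ++ ws2) I x = cadd (lincomb cs1 ws1 I x) (lincomb cs2 ws2 I x).
Proof.
  revert ws1; induction cs1 as [|c cs1 IH]; intros [|w ws1] H; try discriminate; unfold lincomb in *; simpl.
  - now rewrite cadd0.
  - rewrite IH by now injection H. apply caddA.
Qed.

Lemma lincomb_modes n mu cs vs I x :
  lincomb cs (map (mode_form n mu) vs) I x = mode n mu (lincombv cs vs I) x.
Proof.
  revert vs; induction cs as [|c cs IH]; intros [|v vs]; unfold lincomb, lincombv, mode in *; simpl;
    rewrite ?cmul0; try reflexivity.
  rewrite IH, cmulDl; f_equal; unfold mode_form, mode; apply cmulA.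
Qed.

Lemma coef_lincomb_miss n b bs m cs ws I : dual_basis n b bs ->
  Forall (fun w => exists m' a, ~ agree n m m' /\ w = mode_form n (freq n bs m') a) ws ->
  ccont n (fun x => lincomb cs ws I x) /\ coef b m n (fun x => lincomb cs ws I x) = fun _ => c0.
Proof.
  intros Hb H; revert cs; induction H as [|w ws [m' [a [Hm ->]]] H IH]; intros cs.
  { destruct cs; unfold lincomb; simpl; (split; [apply ccont_0|apply (coef_0 n)]). }
  destruct cs as [|c cs]; [unfold lincomb; simpl; split; [apply ccont_0|apply (coef_0 n)]|].
  destruct (IH cs) as [IH1 IH2].
  assert (Cm : ccont n (fun x => cmul c (mode_form n (freq n bs m') a I x))).
  { apply ccont_mul, mode_cont. }
  unfold lincomb; simpl; fold (lincomb cs ws).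
  change (ccont n (fun x => cadd (cmul c (mode_form n (freq n bs m') a I x)) (lincomb cs ws I x)) /\
    coef b m n (fun x => cadd (cmul c (mode_form n (freq n bs m') a I x)) (lincomb cs ws I x)) = fun _ => c0).
  split; [now apply ccont_add|].
  etransitivity; [exact (coef_add n b m n _ _ Cm IH1)|]; rewrite IH2.
  rewrite (coef_mul n) by apply mode_cont.
  destruct (not_agree n m m' Hm) as [l [Hl Hne]].
  unfold mode_form; rewrite (coef_mode_diff n b bs m m' n l _ Hb Hl (le_n n) Hne).
  apply functional_extensionality; intros x; now rewrite cmulr0, cadd0.
Qed.

(** Bases at distinct frequencies are concatenated. For independence, projecting a vanishing
    combination onto the head frequency m kills every form of the tail, so the first D coefficients
    are treated by the basis at m and the rest by induction. *)
Lemma mode_basis n b bs lam D ms : dual_basis n b bs -> distinct n ms ->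
  (forall m, In m ms -> exists vs, length vs = D /\ vbasis (symbol_eig n (freq n bs m) lam) vs) ->
  exists ws, length ws = (length ms * D)%nat /\
    Forall (fun w => exists m a, In m ms /\ symbol_eig n (freq n bs m) lam a /\
                                 w = mode_form n (freq n bs m) a) ws /\
    (forall cs, length cs = length ws -> (forall I x, lincomb cs ws I x = c0) -> Forall (fun c => c = c0) cs) /\
    (forall al : (nat -> Z) -> list nat -> Cx,
       (forall m, In m ms -> symbol_eig n (freq n bs m) lam (al m)) ->
       exists cs, length cs = length ws /\
         forall I x, csum ms (fun m => mode_form n (freq n bs m) (al m) I x) = lincomb cs ws I x).
Proof.
  intros Hb Hd; induction Hd as [|m ms Hm Hd IH]; intros HV.
  { exists nil; repeat split; auto.
    - intros [|] ? _; [constructor|discriminate].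
    - intros al _; exists nil; split; reflexivity. }
  destruct IH as [ws [Lw [Fw [Iw Sw]]]]; [intros; apply HV; simpl; auto|].
  destruct (HV m) as [vs [Lv [Fv [Iv Sv]]]]; [simpl; auto|].
  exists (map (mode_form n (freq n bs m)) vs ++ ws).
  assert (Lm : length (map (mode_form n (freq n bs m)) vs) = D) by now rewrite length_map.
  repeat split.
  - rewrite length_app, Lm, Lw; simpl; lia.
  - apply Forall_app; split.
    + apply Forall_map; eapply Forall_impl; [|exact Fv]; intros a Ha.
      exists m, a; simpl; auto.
    + eapply Forall_impl; [|exact Fw]; intros w [m' [a [H1 H2]]]; exists m', a; simpl; auto.
  - intros cs Lc H0.
    assert (Hsp := firstn_skipn D cs).
    set (cs1 := firstn D cs) in *; set (cs2 := skipn D cs) in *.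
    rewrite length_app, Lm in Lc.
    assert (L1 : length cs1 = D) by (unfold cs1; rewrite length_firstn; lia).
    assert (L2 : length cs2 = length ws) by (unfold cs2; rewrite length_skipn; lia).
    assert (H : forall I x, cadd (mode n (freq n bs m) (lincombv cs1 vs I) x) (lincomb cs2 ws I x) = c0).
    { intros I x; rewrite <- (H0 I x), <- Hsp, lincomb_app by congruence; now rewrite lincomb_modes. }
    assert (Z1 : forall I, lincombv cs1 vs I = c0).
    { intros I.
      destruct (coef_lincomb_miss n b bs m cs2 ws I Hb) as [K1 K2].
      { eapply Forall_impl; [|exact Fw]; intros w [m' [a [H1 [_ H3]]]]; exists m', a; split; auto. }
      assert (E := coef_add n b m n (mode n (freq n bs m) (lincombv cs1 vs I)) (fun x => lincomb cs2 ws I x)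
        (mode_cont _ _ _) K1).
      rewrite K2, (coef_mode_same n b) in E by (assumption || lia).
      apply (f_equal (fun h => h (fun _ => 0))) in E.
      rewrite mode_0, caddr0 in E; rewrite <- E.
      replace (fun x => cadd (mode n (freq n bs m) (lincombv cs1 vs I) x) (lincomb cs2 ws I x))
        with (fun _ : Pt => c0) by (symmetry; apply functional_extensionality; intros; apply H).
      now rewrite (coef_0 n). }
    rewrite <- Hsp; apply Forall_app; split.
    + apply Iv; [congruence|exact Z1].
    + apply Iw; [exact L2|]; intros I x; rewrite <- (H I x), Z1.
      unfold mode; now rewrite cmul0, cadd0.
  - intros al Hal.
    destruct (Sw al) as [cs2 [L2 E2]]; [intros; apply Hal; simpl; auto|].
    destruct (Sv (al m)) as [cs1 [L1 E1]]; [apply Hal; simpl; auto|].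
    exists (cs1 ++ cs2); split.
    + rewrite !length_app, Lm; congruence.
    + intros I x; rewrite lincomb_app by congruence.
      rewrite lincomb_modes, <- E1, <- E2; reflexivity.
Qed.

(** The last hypothesis, applied to the amplitudes of an eigenform, confines them to the list ms, so
    that the finite expansion is available. *)
Lemma eigensp_cdim n b bs lam D ms : dual_basis n b bs -> faces_valid n -> distinct n ms ->
  (forall m, In m ms -> exists vs, length vs = D /\ vbasis (symbol_eig n (freq n bs m) lam) vs) ->
  (forall m a I, symbol_eig n (freq n bs m) lam a -> a I <> c0 -> exists m', In m' ms /\ agree n m m') ->
  cdim (eigensp n b lam) (length ms * D).
Proof.
  intros Hb Hf Hd HV Hms.
  destruct (mode_basis n b bs lam D ms Hb Hd HV) as [ws [Lw [Fw [Iw Sw]]]].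
  exists ws; repeat split; [exact Lw| | |].
  - eapply Forall_impl; [|exact Fw]; intros w [m [a [_ [Ha ->]]]].
    apply mode_form_eigen; [now apply dual_freq|exact Ha].
  - intros cs Lc; apply Iw; congruence.
  - intros w Hw; destruct (Sw (amp n b w)) as [cs [Lc E]].
    + intros m _; now apply (amp_eig n b).
    + exists cs; split; [congruence|]; intros I x; rewrite <- E.
      apply (eigenform_expansion n b bs lam); try assumption.
      intros m I' HI; apply (Hms m (amp n b w m) I'); [now apply (amp_eig n b)|exact HI].
Qed.

Lemma eigenvalue_mode n b bs lam : dual_basis n b bs -> faces_valid n -> is_eigenvalue n b lam ->
  exists m a I, symbol_eig n (freq n bs m) lam a /\ a I <> c0.
Proof.
  intros Hb Hf [w [Hw [I [x Hx]]]].
  destruct (admissible_comp n b w I (proj1 Hw)) as [Cw Pw].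
  destruct (coef_unique n b n (w I) x Cw Pw (le_n n) Hx) as [m Hm].
  exists m, (amp n b w m), I; split; [now apply amp_eig|].
  intros E; apply Hm; rewrite (amp_mode n b bs) by (assumption || apply Hw).
  rewrite E; apply cmul0.
Qed.

(** * The finite set of frequencies on a sphere *)

Lemma integer_boxes n B : exists L : list (nat -> Z), forall m,
  (forall j, (j < n)%nat -> (Z.abs (m j) <= B)%Z) -> exists m', In m' L /\ agree n m m'.
Proof.
  induction n as [|n [L IH]].
  - exists ((fun _ => 0%Z) :: nil); intros m _; eexists; split; [left; reflexivity|].
    intros l Hl; lia.
  - exists (flat_map (fun m' => map (fun z l => if Nat.eqb l n then (Z.of_nat z - B)%Z else m' l)
      (seq 0 (Z.to_nat (2 * B + 1)))) L).
    intros m Hm; destruct (IH m) as [m' [Hin Ha]]; [intros; apply Hm; lia|].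
    eexists; split.
    + apply in_flat_map; exists m'; split; [exact Hin|].
      apply in_map_iff; exists (Z.to_nat (m n + B)); split; [reflexivity|].
      specialize (Hm n ltac:(lia)); apply in_seq; lia.
    + intros l Hl; simpl; destruct (Nat.eqb_spec l n) as [->|Hn].
      * specialize (Hm n ltac:(lia)); rewrite Z2Nat.id; lia.
      * apply Ha; lia.
Qed.

(** The predicate in view is an equality of real norms, which cannot be decided by computation, so
    members are kept or dropped by excluded middle. Invariance under [agree] allows any
    representative to be kept. *)
Lemma select_distinct n (Q : (nat -> Z) -> Prop) (L : list (nat -> Z)) :
  (forall m m', agree n m m' -> Q m -> Q m') ->
  exists ms, distinct n ms /\ Forall Q ms /\
    forall m, Q m -> (exists m', In m' L /\ agree n m m') -> exists m', In m' ms /\ agree n m m'.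
Proof.
  intros HQ; induction L as [|m0 L [ms [Hd [HF HC]]]].
  - exists nil; split; [constructor|split; [constructor|]]; intros m _ [m' [[] _]].
  - destruct (classic (Q m0 /\ ~ exists m', In m' ms /\ agree n m0 m')) as [[HQ0 Hno]|Hel].
    + exists (m0 :: ms); repeat split.
      * constructor; [|exact Hd]; intros m' Hin Ha; apply Hno; eauto.
      * constructor; assumption.
      * intros m Hm [m' [[<-|Hin] Ha]]; [exists m0; simpl; auto|].
        destruct (HC m Hm) as [m'' [H1 H2]]; [eauto|exists m''; simpl; auto].
    + exists ms; repeat split; [exact Hd|exact HF|].
      intros m Hm [m' [[<-|Hin] Ha]]; [|apply HC; eauto].
      apply NNPP; intros HN; apply Hel; split; [now apply (HQ m)|].
      intros [m' [Hin Ha']]; apply HN; exists m'; split; [exact Hin|].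
      intros l Hl; rewrite Ha, Ha' by exact Hl; reflexivity.
Qed.

Lemma vnorm_coord n v i : (i < n)%nat -> Rabs (v i) <= vnorm n v.
Proof.
  intros Hi; unfold vnorm; rewrite <- sqrt_Rsqr_abs; apply sqrt_le_1_alt.
  assert (P : forall k, 0 <= rsum k (fun i => v i * v i)).
  { induction k; simpl; [lra|nra]. }
  induction n as [|n IH]; [lia|]; simpl; destruct (Nat.eq_dec i n) as [->|Hn].
  - generalize (P n); unfold Rsqr; lra.
  - specialize (IH ltac:(lia)); nra.
Qed.

Lemma rsum_Rabs_le n f : Rabs (rsum n f) <= rsum n (fun i => Rabs (f i)).
Proof.
  induction n as [|n IH]; simpl; [rewrite Rabs_R0; lra|].
  eapply Rle_trans; [apply Rabs_triang|lra].
Qed.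

Lemma rsum_le n f g : (forall i, (i < n)%nat -> f i <= g i) -> rsum n f <= rsum n g.
Proof.
  intros H; induction n as [|n IH]; simpl; [lra|].
  specialize (H n ltac:(lia)) as Hn; assert (rsum n f <= rsum n g) by auto; lra.
Qed.

Lemma vnorm_ext n u v : (forall i, (i < n)%nat -> u i = v i) -> vnorm n u = vnorm n v.
Proof. intros H; unfold vnorm; f_equal; apply rsum_ext; intros; now rewrite H. Qed.

(** Finiteness: m_j is the pairing of the frequency with b_j, and every coordinate of a vector of
    norm r is at most r, so |m_j| is bounded by the sum of r |b_j i| over i. *)
Lemma sphere_frequencies n b bs r : dual_basis n b bs ->
  exists ms, distinct n ms /\ Forall (fun m => vnorm n (freq n bs m) = r) ms /\
    forall m, vnorm n (freq n bs m) = r -> exists m', In m' ms /\ agree n m m'.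
Proof.
  intros Hb.
  assert (HB : exists B, forall m, vnorm n (freq n bs m) = r ->
     forall j, (j < n)%nat -> (Z.abs (m j) <= B)%Z).
  { assert (HB : forall k, (k <= n)%nat -> exists B, forall m, vnorm n (freq n bs m) = r ->
     forall j, (j < k)%nat -> (Z.abs (m j) <= B)%Z).
    { induction k as [|k IH]; intros Hk; [exists 0%Z; intros; lia|].
      destruct IH as [B HB]; [lia|].
      set (S := rsum n (fun i => r * Rabs (b k i))).
      exists (Z.max B (up S)); intros m Hm j Hj.
      destruct (Nat.eq_dec j k) as [->|Hn]; [|specialize (HB m Hm j ltac:(lia)); lia].
      assert (Z.abs (m k) < up S)%Z; [|lia].
      apply lt_IZR; eapply Rle_lt_trans; [|apply archimed].
      rewrite abs_IZR, <- (dot_freq_basis n b bs m k Hb) by lia.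
      eapply Rle_trans; [apply rsum_Rabs_le|]; apply rsum_le; intros i Hi.
      rewrite Rabs_mult; apply Rmult_le_compat_r; [apply Rabs_pos|].
      rewrite <- Hm; now apply vnorm_coord. }
    now apply HB. }
  destruct HB as [B HB]; destruct (integer_boxes n B) as [L HL].
  destruct (select_distinct n (fun m => vnorm n (freq n bs m) = r) L) as [ms [Hd [HF HC]]].
  { intros m m' Ha E; now rewrite <- (agree_freq n bs m m' Ha). }
  exists ms; split; [exact Hd|split; [exact HF|]].
  intros m Hm; apply HC; [exact Hm|apply HL, HB, Hm].
Qed.

Lemma freq_inj n b bs m m' : dual_basis n b bs ->
  (forall i, (i < n)%nat -> freq n bs m i = freq n bs m' i) -> agree n m m'.
Proof.
  intros Hb H l Hl; apply eq_IZR; rewrite <- !(dot_freq_basis n b bs) by assumption.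
  apply rsum_ext; intros i Hi; now rewrite H.
Qed.

Lemma distinct_nth n ms a c m0 : distinct n ms -> (a < c)%nat -> (c < length ms)%nat ->
  ~ agree n (nth a ms m0) (nth c ms m0).
Proof.
  intros Hd; revert a c; induction Hd as [|m ms Hm Hd IH]; simpl; [lia|].
  intros [|a] [|c] Hac Hc; try lia.
  - apply Hm, nth_In; lia.
  - apply IH; lia.
Qed.

Lemma card_frequencies n b bs r ms : dual_basis n b bs -> distinct n ms ->
  Forall (fun m => vnorm n (freq n bs m) = r) ms ->
  (forall m, vnorm n (freq n bs m) = r -> exists m', In m' ms /\ agree n m m') ->
  card_vecs n (fun mu => dual_mem n b mu /\ vnorm n mu = r) (length ms).
Proof.
  intros Hb Hd HF HC; exists (map (freq n bs) ms).
  assert (Nth : forall a, (a < length ms)%nat ->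
    nth a (map (freq n bs) ms) (fun _ => 0) = freq n bs (nth a ms (fun _ => 0%Z))).
  { intros a Ha; rewrite (nth_indep _ _ (freq n bs (fun _ => 0%Z))) by now rewrite length_map.
    apply map_nth. }
  repeat split.
  - apply length_map.
  - apply Forall_map; eapply Forall_impl; [|exact HF]; intros m Hm; split; [now apply dual_freq|exact Hm].
  - intros a c Hac Hc; rewrite !Nth by lia; apply NNPP; intros HN.
    apply (distinct_nth n ms a c (fun _ => 0%Z) Hd Hac Hc); apply (freq_inj n b bs _ _ Hb).
    intros i Hi; apply NNPP; intros E; apply HN; eauto.
  - intros mu [Hmu Hr]; destruct (dual_mem_freq n b bs mu Hb Hmu) as [m Hm].
    destruct (HC m) as [m' [Hin Ha]]; [rewrite <- Hr; symmetry; now apply vnorm_ext|].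
    destruct (In_nth ms m' (fun _ => 0%Z) Hin) as [a [Ha1 Ha2]].
    exists a; split; [exact Ha1|]; intros i Hi.
    rewrite Nth, Ha2, Hm by assumption; now rewrite (agree_freq n bs m m' Ha).
Qed.

(** The scalar in front of star o (mu /\ -): -2 pi if n = 1 mod 4, and 2 i pi otherwise. *)
Definition symb_const n : Cx :=
  cmul (if Nat.eqb (Nat.modulo n 4) 1 then (0, 1) else (1, 0)) (0, 2 * PI).

Lemma partial_symbol r : (0, 2 * PI * r) = cmul (0, 2 * PI) (r, 0).
Proof. apply Cx_eq; unfold cmul; simpl; ring. Qed.

Lemma symb_const_sq n : cmul (symb_const n) (symb_const n) =
  cmul ((if Nat.eqb (Nat.modulo n 4) 1 then 1 else -1), 0) (2 * PI * (2 * PI), 0).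
Proof.
  unfold symb_const; destruct (Nat.eqb (n mod 4) 1); apply Cx_eq; unfold cmul; simpl; ring.
Qed.

Lemma rsum_sq_ge0 n (v : Pt) : 0 <= rsum n (fun i => v i * v i).
Proof. induction n as [|n IH]; simpl; [lra|nra]. Qed.

Lemma sphere_sq n mu lam : Rabs lam = 2 * PI * vnorm n mu <->
  lam * lam = 2 * PI * (2 * PI) * rsum n (fun i => mu i * mu i).
Proof.
  assert (S := sqrt_sqrt _ (rsum_sq_ge0 n mu)); fold (vnorm n mu) in S.
  assert (V : 0 <= vnorm n mu) by apply sqrt_pos.
  assert (HP := PI_RGT_0).
  assert (A : Rabs lam * Rabs lam = lam * lam) by (rewrite <- Rabs_mult; apply Rabs_right; nra).
  assert (A0 := Rabs_pos lam).
  rewrite <- S, <- A; split; intros H; [rewrite H; ring|].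
  assert (0 <= 2 * PI * vnorm n mu) by (apply Rmult_le_pos; lra).
  apply Rsqr_inj; [assumption|assumption|unfold Rsqr; rewrite H; ring].
Qed.

(** If E contained only 0, the combination of the basis with all coefficients 1 would vanish,
    against independence. *)
Lemma vbasis_nonzero E vs : vbasis E vs -> (0 < length vs)%nat ->
  exists a I, E a /\ a I <> c0.
Proof.
  intros [F [H _]] Hl; apply NNPP; intros HN.
  assert (Z : Forall (fun v => forall I, v I = c0) vs).
  { eapply Forall_impl; [|exact F]; intros a Ha I; apply NNPP; intros HI; apply HN; exists a, I; auto. }
  assert (Z2 : Forall (fun c => c = c0) (repeat ((1, 0) : Cx) (length vs))).
  { apply H; [apply repeat_length|]; intros I; clear - Z; unfold lincombv.
    induction Z as [|v vs Hv Z IH]; simpl; [reflexivity|].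
    now rewrite IH, Hv, cmulr0, cadd0. }
  destruct vs; simpl in *; [lia|]; inversion Z2 as [|? ? E0]; injection E0; lra.
Qed.

End Eigenforms.

(** * Exterior algebra on subsets of {0, ..., n - 1} and the Clifford relation *)

Module LinAlg.
Import all_boot all_algebra ring.
Set Implicit Arguments. Unset Strict Implicit. Unset Printing Implicit Defensive.
Import GRing.Theory Num.Theory.
Local Open Scope ring_scope.

Section Star.
Variables (F : numFieldType) (n k : nat) (mu : 'I_n -> F) (c lam : F).

(** For j in A this is the position of j in the increasing enumeration of A, which is the exponent
    of the sign attached to j in the exterior derivative. *)
Definition below (A : {set 'I_n}) (j : 'I_n) : nat := (\sum_(i in A) (i < j))%N.
Definition inversions (A B : {set 'I_n}) : nat := (\sum_(a in A) below B a)%N.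
Definition wsign (j : 'I_n) (A : {set 'I_n}) : F := (-1) ^+ below A j.
Definition starsign (A : {set 'I_n}) : F := (-1) ^+ inversions (~: A) A.

Definition wedge (a : {set 'I_n} -> F) (B : {set 'I_n}) : F :=
  \sum_(j in B) mu j * wsign j B * a (B :\ j).
Definition contract (a : {set 'I_n} -> F) (A : {set 'I_n}) : F :=
  \sum_(j in ~: A) mu j * wsign j A * a (j |: A).
Definition star (a : {set 'I_n} -> F) (A : {set 'I_n}) : F :=
  starsign A * a (~: A).
(* Indexed by all subsets but zero off the k-subsets: eigenvectors for lam <> 0 are then
   automatically supported on the k-subsets. *)
Definition symb (a : {set 'I_n} -> F) (A : {set 'I_n}) : F :=
  if #|A| == k then c * star (wedge a) A else 0.

Lemma signr_mul2 (m : nat) : (-1) ^+ m * (-1) ^+ m = 1 :> F.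
Proof. by rewrite -exprD addnn -mul2n exprM sqrrN !expr1n. Qed.

Lemma below1U (A : {set 'I_n}) (i j : 'I_n) : j \notin A ->
  below (j |: A) i = ((j < i) + below A i)%N.
Proof. by move=> jA; rewrite /below big_setU1. Qed.

Lemma belowD1 (A : {set 'I_n}) (i j : 'I_n) : j \in A ->
  below A i = ((j < i) + below (A :\ j) i)%N.
Proof. by move=> jA; rewrite {1}/below (big_setD1 j). Qed.

Lemma wsignU1 (A : {set 'I_n}) (i j : 'I_n) : j \notin A ->
  wsign i (j |: A) = (-1) ^+ (j < i)%N * wsign i A.
Proof. by move=> jA; rewrite /wsign below1U // exprD. Qed.

Lemma wsignD1 (A : {set 'I_n}) (i j : 'I_n) : j \in A ->
  wsign i (A :\ j) = (-1) ^+ (j < i)%N * wsign i A.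
Proof.
by move=> jA; rewrite /wsign (belowD1 _ jA) exprD mulrA signr_mul2 mul1r.
Qed.

Lemma wsign_sq (A : {set 'I_n}) (i : 'I_n) : wsign i A * wsign i A = 1.
Proof. exact: signr_mul2. Qed.

(** Exactly one of i < j and j < i holds; all anticommutation below comes from here. *)
Lemma sign_swap (i j : 'I_n) : i != j ->
  (-1) ^+ (j < i)%N = - (-1) ^+ (i < j)%N :> F.
Proof.
by move=> /negP ij; case: (ltngtP i j) => [||/val_inj/eqP //] _;
  rewrite ?expr0 ?expr1 ?opprK.
Qed.

Lemma sum_antisym (G : 'I_n -> 'I_n -> F) : (forall i j, G i j = - G j i) ->
  \sum_i \sum_j G i j = 0.
Proof.
move=> anti; set s := \sum_i _.
have : s = - s.
  rewrite {2}/s exchange_big /= -sumrN; apply: eq_bigr => i _.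
  by rewrite -sumrN; apply: eq_bigr => j _; rewrite anti.
by move/eqP; rewrite -addr_eq0 -mulr2n mulrn_eq0 => /eqP.
Qed.

(** Removing i and then j leaves the same subset as removing j and then i, with the opposite sign.
    The summand G is extended by 0 to all pairs so that its antisymmetry holds without
    conditions. *)
Lemma wedge_wedge a B : wedge (wedge a) B = 0.
Proof.
pose G i j : F := if [&& i \in B, j \in B & i != j] then
   mu i * wsign i B * (mu j * wsign j (B :\ i) * a (B :\ i :\ j)) else 0.
rewrite /wedge big_mkcond /= -[RHS](@sum_antisym G) => [|i j].
  apply: eq_bigr => i _; rewrite /G; case: ifP => [iB|_] /=; last first.
    by rewrite big1.
  rewrite mulr_sumr big_mkcond; apply: eq_bigr => j _ /=.
  by rewrite !inE [j == i]eq_sym andbC.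
rewrite /G [j == i]eq_sym andbCA; case: ifP => [/and3P[jB iB ij]|_]; last by rewrite oppr0.
rewrite (wsignD1 _ iB) (wsignD1 _ jB) (sign_swap ij).
have -> : B :\ j :\ i = B :\ i :\ j by apply/setP=> x; rewrite !inE andbCA.
ring.
Qed.

(** The Clifford relation. Adding and removing the same index returns mu_j^2, from contract after
    wedge if j is outside A and from wedge after contract if j is in A. The mixed terms G, which add
    j outside A and remove i in A, appear in the two orders with opposite signs. *)
Lemma contract_wedge a A :
  contract (wedge a) A = (\sum_j mu j ^+ 2) * a A - wedge (contract a) A.
Proof.
pose G i j : F := if (j \notin A) && (i \in A) then
   mu j * wsign j A * (mu i * wsign i (j |: A) * a ((j |: A) :\ i)) else 0.
have -> : contract (wedge a) A =
    (\sum_(j in ~: A) mu j ^+ 2) * a A + \sum_j \sum_i G i j.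
  rewrite /contract mulr_suml [X in _ + X](bigID (mem (~: A))) /=.
  rewrite [X in _ + (_ + X)]big1 ?addr0 => [|j jA]; last first.
    by rewrite big1 // => i _; rewrite /G; rewrite inE in jA; rewrite (negbTE jA).
  rewrite -big_split /=; apply: eq_bigr => j; rewrite inE => jA.
  rewrite /wedge big_setU1 //= mulrDr setU1K // (wsignU1 _ jA) ltnn expr0 mul1r.
  congr (_ + _).
    by rewrite expr2 -[RHS]mul1r -(wsign_sq A j); ring.
  rewrite mulr_sumr big_mkcond; apply: eq_bigr => i _.
  by rewrite /G jA.
have -> : wedge (contract a) A =
    (\sum_(i in A) mu i ^+ 2) * a A - \sum_i \sum_j G i j.
  rewrite /wedge mulr_suml [X in _ - X](bigID (mem A)) /=.
  rewrite [X in _ - (_ + X)]big1 ?addr0 => [|i iA]; last first.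
    by rewrite big1 // => j _; rewrite /G (negbTE iA) andbF.
  rewrite -sumrB; apply: eq_bigr => i iA.
  have -> : contract a (A :\ i) = mu i * wsign i (A :\ i) * a (i |: A :\ i)
      + \sum_(j in ~: A) mu j * wsign j (A :\ i) * a (j |: A :\ i).
    have -> : contract a (A :\ i) =
        \sum_(j in i |: ~: A) mu j * wsign j (A :\ i) * a (j |: A :\ i).
      by apply: eq_bigl => j; rewrite !inE negb_and negbK.
    by rewrite big_setU1 // inE iA.
  rewrite mulrDr setD1K // (wsignD1 _ iA) ltnn expr0 mul1r.
  congr (_ + _).
    by rewrite expr2 -[RHS]mul1r -(wsign_sq A i); ring.
  rewrite mulr_sumr -sumrN [RHS](bigID (mem (~: A))) /=.
  rewrite [X in _ = _ + X]big1 ?addr0 => [|j jA]; last first.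
    by rewrite /G; rewrite inE in jA; rewrite (negbTE jA) oppr0.
  apply: eq_bigr => j; rewrite inE => jA; rewrite /G jA iA /=.
  have ij : i != j by apply: contraNneq jA => <-.
  rewrite (wsignU1 _ jA) (wsignD1 _ iA) (sign_swap ij).
  have -> : (j |: A) :\ i = j |: A :\ i.
    by apply/setP=> x; rewrite !inE; case: (x =P i) => [->|]; rewrite ?(negbTE ij).
  ring.
have -> : \sum_j mu j ^+ 2 =
    \sum_(j in A) mu j ^+ 2 + \sum_(j in ~: A) mu j ^+ 2.
  rewrite (bigID (mem A)) /=; congr (_ + _).
  by apply: eq_bigl => j; rewrite inE.
rewrite exchange_big /=; ring.
Qed.

Lemma inversions1U (A B : {set 'I_n}) j : j \notin A ->
  inversions (j |: A) B = (below B j + inversions A B)%N.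
Proof. by move=> jA; rewrite /inversions big_setU1. Qed.

(** Each pair (a, b) is an inversion in exactly one of the two orders. *)
Lemma inversionsC (A B : {set 'I_n}) : [disjoint A & B] ->
  (inversions A B + inversions B A = #|A| * #|B|)%N.
Proof.
move=> dAB; rewrite /inversions /below [X in (_ + X)%N]exchange_big -big_split /=.
rewrite -sum_nat_const; apply: eq_bigr => a aA.
rewrite -big_split /= -[RHS]sum1_card; apply: eq_bigr => b bB.
case: (ltngtP a b) => // /val_inj ab.
by move: dAB; rewrite disjoints_subset => /subsetP/(_ a aA); rewrite inE ab bB.
Qed.

Hypotheses (hn : n = k.*2.+1) (k_gt0 : (0 < k)%N) (lam_neq0 : lam != 0).
(** The factor c^2 (-1)^k is the one that the square of the symbol carries. For the constant of the
    curl it equals (2 pi)^2, and the hypothesis then says |lam| = 2 pi |mu|. *)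
Hypothesis hlam : c ^+ 2 * (-1) ^+ k * \sum_j mu j ^+ 2 = lam ^+ 2.

Lemma card_setCD1 (A : {set 'I_n}) j : #|A| = k -> j \in ~: A -> #|~: A :\ j| = k.
Proof.
move=> cA jA; have := cardsD1 j (~: A); rewrite jA cardsCs setCK card_ord cA.
have -> : (n - k = k.+1)%N by rewrite hn -addnn -addSn addnK.
by move=> e; apply: succn_inj; rewrite e.
Qed.

(** Let B be the complement of A without j. The number [below B j] enters twice and cancels,
    [below A j] gives the sign of the contraction, and the inversions of (A, B) and (B, A) add up to
    k^2, which has the parity of k. *)
Lemma star_wedge_star a (A : {set 'I_n}) : #|A| = k ->
  star (wedge (star a)) A = (-1) ^+ k * contract a A.
Proof.
move=> cA; rewrite /star /wedge /contract !mulr_sumr; apply: eq_bigr => j jA.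
have cB := card_setCD1 cA jA.
set B := ~: A :\ j in cB *.
have jA' : j \notin A by rewrite inE in jA.
have jB : j \notin B by rewrite !inE eqxx.
have eB : ~: B = j |: A by rewrite /B setCD setCK setUC.
have eA : ~: A = j |: B by rewrite /B setD1K.
have dAB : [disjoint B & A] by rewrite disjoints_subset /B subsetDl.
rewrite /starsign /wsign eB eA !inversions1U // below1U // ltnn add0n.
have -> : (-1) ^+ k = (-1) ^+ (inversions B A + inversions A B) :> F.
  by rewrite inversionsC // cB cA -[RHS]signr_odd oddM andbb signr_odd.
rewrite !exprD; have := signr_mul2 (below B j).
set u := (-1) ^+ below B j => uu.
transitivity ((u * u) * ((-1) ^+ below A j * (-1) ^+ inversions B A
   * (mu j * (-1) ^+ inversions A B * a (j |: A)))); first ring.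
rewrite uu; ring.
Qed.

Lemma eq_wedge a a' (B : {set 'I_n}) : (forall j, j \in B -> a (B :\ j) = a' (B :\ j)) ->
  wedge a B = wedge a' B.
Proof. by move=> e; apply: eq_bigr => j jB; rewrite e. Qed.

Lemma wedgeZ x a B : wedge (fun A => x * a A) B = x * wedge a B.
Proof. by rewrite /wedge mulr_sumr; apply: eq_bigr => j _; ring. Qed.

Lemma symb_symb a (A : {set 'I_n}) : #|A| = k ->
  symb (symb a) A = c ^+ 2 * (-1) ^+ k * contract (wedge a) A.
Proof.
move=> cA; rewrite {1}/symb cA eqxx {1}/star.
rewrite (@eq_wedge _ (fun B => c * star (wedge a) B)) => [|j jA]; last first.
  by rewrite /symb card_setCD1 ?eqxx.
rewrite wedgeZ.
transitivity (c ^+ 2 * star (wedge (star (wedge a))) A); first by rewrite /star; ring.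
by rewrite star_wedge_star // mulrA.
Qed.

(* (star wedge)^2 = +- contract wedge, and contract wedge + wedge contract = |mu|^2. *)
Lemma symb_cube a A : symb (symb (symb a)) A = lam ^+ 2 * symb a A.
Proof.
rewrite {1}/symb [in RHS]/symb; case: ifP => [/eqP cA|]; last by rewrite mulr0.
rewrite {1}/star.
rewrite (@eq_wedge _ (fun B => c ^+ 2 * (-1) ^+ k * contract (wedge a) B)); last first.
  by move=> j jA; rewrite symb_symb // card_setCD1.
rewrite wedgeZ.
have -> : wedge (contract (wedge a)) (~: A) = (\sum_j mu j ^+ 2) * wedge a (~: A).
  have := contract_wedge (wedge a) (~: A).
  rewrite [contract _ _]big1 => [/esym/eqP|j _]; last by rewrite wedge_wedge mulr0.
  by rewrite subr_eq0 => /eqP.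
by rewrite -hlam /star; ring.
Qed.

(** * The symbol as a matrix: traces, eigenprojection and rank *)

Local Notation N := #|{set 'I_n}|.
Definition dirac (B A : {set 'I_n}) : F := (A == B)%:R.

Lemma diracxx B : dirac B B = 1.
Proof. by rewrite /dirac eqxx. Qed.

Lemma dirac_neq A B : A != B -> dirac B A = 0.
Proof. by rewrite /dirac => /negbTE ->. Qed.

Lemma col_mulmx p q r (A : 'M[F]_(p, q)) (B : 'M[F]_(q, r)) s :
  A *m col s B = col s (A *m B).
Proof. by apply/matrixP => i j; rewrite !mxE; apply: eq_bigr => t _; rewrite mxE. Qed.

Definition symbmx : 'M[F]_N :=
  \matrix_(r, s) symb (dirac (enum_val s)) (enum_val r).

Lemma symb_lin a A : symb a A = \sum_B symb (dirac B) A * a B.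
Proof.
rewrite /symb; case: ifP => [_|_]; last by rewrite big1 // => B _; rewrite mul0r.
rewrite /star /wedge !mulr_sumr.
under [RHS]eq_bigr => B _ do rewrite !mulr_sumr mulr_suml.
rewrite exchange_big /=; apply: eq_bigr => j _.
rewrite (bigD1 (~: A :\ j)) //= big1 => [|B nB].
  by rewrite diracxx addr0; ring.
by rewrite dirac_neq 1?eq_sym //; ring.
Qed.

Lemma symb_mx (a : {set 'I_n} -> F) :
  symbmx *m (\col_r a (enum_val r)) = \col_r symb a (enum_val r).
Proof.
apply/matrixP => r s; rewrite !mxE symb_lin (reindex (@enum_val _ (mem {set 'I_n}))) /=.
  by apply: eq_bigr => t _; rewrite !mxE.
by apply: onW_bij; exact: enum_val_bij.
Qed.

Lemma symbmx_mul (A : 'cV[F]_N) (a : {set 'I_n} -> F) :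
  A = \col_r a (enum_val r) -> symbmx *m A = \col_r symb a (enum_val r).
Proof. by move=> ->; exact: symb_mx. Qed.

Lemma col_symbmx s : col s symbmx = \col_r symb (dirac (enum_val s)) (enum_val r).
Proof. by apply/matrixP => r t; rewrite !mxE. Qed.

Lemma col_symbmx2 s :
  col s (symbmx *m symbmx) = \col_r symb (symb (dirac (enum_val s))) (enum_val r).
Proof. by rewrite -col_mulmx col_symbmx symb_mx. Qed.

Lemma symbmx_cube : symbmx *m (symbmx *m symbmx) = lam ^+ 2 *: symbmx.
Proof.
apply/matrixP => r s.
have -> : (symbmx *m (symbmx *m symbmx)) r s = col s (symbmx *m (symbmx *m symbmx)) r 0.
  by rewrite [RHS]mxE.
by rewrite -col_mulmx col_symbmx2 symb_mx !mxE symb_cube.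
Qed.

(** A diagonal entry at A requires the complement of A minus j to be A itself; these sets are
    disjoint, and A is nonempty because k > 0. *)
Lemma tr_symbmx : \tr symbmx = 0.
Proof.
rewrite /mxtrace big1 // => r _; rewrite mxE /symb; case: ifP => // /eqP cA.
rewrite /star [wedge _ _]big1 ?mulr0 // => j jA.
case: (eqVneq (~: enum_val r :\ j) (enum_val r)) => [e|/dirac_neq->]; last by rewrite mulr0.
have [x xA] : exists x, x \in enum_val r.
  by apply/set0Pn; rewrite -card_gt0 cA.
by have := xA; rewrite -e !inE xA andbF.
Qed.

Lemma card_avoiding (j : 'I_n) :
  #|[set A : {set 'I_n} | (#|A| == k) && (j \in ~: A)]| = 'C(n.-1, k).
Proof.
have -> : n.-1 = #|[set~ j]| by rewrite cardsC1 card_ord.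
rewrite -cards_draws.
apply: eq_card => A; rewrite !inE andbC; congr (_ && _).
by rewrite -setCS setCK sub1set inE.
Qed.

(** By the Clifford relation the diagonal entry at A is, up to c^2 (-1)^k, the sum of mu_j^2 over j
    outside A. Summing over A first, each j is avoided by binom(n-1, k) of the k-subsets. *)
Lemma tr_symbmx2 : \tr (symbmx *m symbmx) = lam ^+ 2 * 'C(n.-1, k)%:R.
Proof.
transitivity (\sum_(A : {set 'I_n}) symb (symb (dirac A)) A).
  rewrite (reindex (@enum_val _ (mem {set 'I_n}))) /=; last first.
    by apply: onW_bij; exact: enum_val_bij.
  apply: eq_bigr => r _; have /matrixP/(_ r 0) := col_symbmx2 r.
  by rewrite !mxE => ->.
transitivity (\sum_(A : {set 'I_n}) \sum_j
    if (#|A| == k) && (j \in ~: A) then c ^+ 2 * (-1) ^+ k * mu j ^+ 2 else 0).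
  apply: eq_bigr => A _; case: (boolP (#|A| == k)) => /= cA; last first.
    by rewrite /symb (negbTE cA) big1.
  rewrite symb_symb ?(eqP cA) // contract_wedge.
  rewrite -big_mkcond /= -mulr_sumr; congr (_ * _).
  have -> : wedge (contract (dirac A)) A = \sum_(j in A) mu j ^+ 2.
    apply: eq_bigr => j jA.
    rewrite /contract (bigD1 j) /=; last by rewrite !inE eqxx.
    rewrite setD1K // big1 ?addr0 => [|i /andP[iA ij]].
      rewrite diracxx (wsignD1 _ jA) ltnn expr0 mul1r mulr1.
      by rewrite expr2 -[RHS]mul1r -(wsign_sq A j); ring.
    rewrite dirac_neq ?mulr0 //; apply/eqP => /setP/(_ j).
    by rewrite !inE eqxx jA [j == i]eq_sym (negbTE ij).
  rewrite diracxx mulr1 (bigID (mem A)) /= addrC addrK.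
  by apply: eq_bigl => j; rewrite inE.
rewrite exchange_big /= -hlam mulr_sumr mulr_suml.
apply: eq_bigr => j _; rewrite -big_mkcond /= sumr_const.
by rewrite -(card_avoiding j) cardsE -[_ *+ _]mulr_natr; congr (_ * _%:R); apply: eq_card.
Qed.


(** From B C B C = B C, cancel B on the left by L and C on the right by K. *)
Lemma idempotent_factors m r (P : 'M[F]_m) (B : 'M_(m, r)) (C : 'M_(r, m)) L K :
  L *m B = 1%:M -> C *m K = 1%:M -> B *m C = P -> P *m P = P -> C *m B = 1%:M.
Proof.
move=> LB CK <- /(congr1 (fun X => L *m X *m K)).
by rewrite -!mulmxA CK mulmx1 !mulmxA LB !mul1mx.
Qed.

(** For a full-rank factorization P = B C, the trace of B C is that of C B, the identity matrix of
    size rank P. *)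
Lemma rank_idempotent m (P : 'M[F]_m) : P *m P = P -> (\rank P)%:R = \tr P.
Proof.
move=> PP; rewrite -{2}(mulmx_base P) mxtrace_mulC.
suff -> : row_base P *m col_base P = 1%:M by rewrite mxtrace1.
have [L LK] := row_fullP (col_base_full P).
have [K KK] := row_freeP (row_base_free P).
exact: idempotent_factors LK KK (mulmx_base P) PP.
Qed.

(** The interpolation polynomial that is 1 at lam and 0 at 0 and -lam, evaluated at the symbol. *)
Definition eigproj : 'M[F]_N :=
  (2%:R * lam ^+ 2)^-1 *: (symbmx *m symbmx + lam *: symbmx).

Lemma two_lam2_neq0 : 2%:R * lam ^+ 2 != 0 :> F.
Proof. by rewrite mulf_neq0 ?pnatr_eq0 // expf_neq0. Qed.

Lemma symbmx_eigproj : symbmx *m eigproj = lam *: eigproj.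
Proof.
rewrite /eigproj -scalemxAr mulmxDr symbmx_cube -scalemxAr.
rewrite [RHS]scalerA [lam * _]mulrC -[RHS]scalerA.
by congr (_ *: _); rewrite scalerDr scalerA -expr2 addrC.
Qed.

Lemma eigproj_fix p (v : 'M[F]_(N, p)) : symbmx *m v = lam *: v -> eigproj *m v = v.
Proof.
move=> e; rewrite /eigproj -scalemxAl mulmxDl -mulmxA e -scalemxAr e.
rewrite -scalemxAl e !scalerA -scalerDl scalerA -expr2 -mulr2n -[lam ^+ 2 *+ 2]mulr_natl.
by rewrite mulVf ?two_lam2_neq0 // scale1r.
Qed.

Lemma eigproj_idem : eigproj *m eigproj = eigproj.
Proof.
exact: eigproj_fix symbmx_eigproj.
Qed.

Lemma tr_eigproj : \tr eigproj = 2%:R^-1 * 'C(n.-1, k)%:R.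
Proof.
rewrite /eigproj mxtraceZ mxtraceD mxtraceZ tr_symbmx mulr0 addr0 tr_symbmx2.
by rewrite invfM -mulrA mulKf // expf_neq0.
Qed.

(** The basis consists of the columns of [col_base eigproj]: its left inverse gives independence,
    and [row_base eigproj] applied to an eigenvector gives the coordinates. The size D is stated as
    an element of F because the trace determines the rank there. *)
Lemma symb_eigenbasis : exists (D : nat) (u : 'I_D -> {set 'I_n} -> F),
  [/\ D%:R = 2%:R^-1 * 'C(n.-1, k)%:R :> F,
      forall q A, symb (u q) A = lam * u q A,
      forall cs : 'I_D -> F, (forall A, \sum_q cs q * u q A = 0) -> forall q, cs q = 0 &
      forall a, (forall A, symb a A = lam * a A) ->
        exists cs : 'I_D -> F, forall A, a A = \sum_q cs q * u q A].
Proof.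
exists (\rank eigproj), (fun q A => col_base eigproj (enum_rank A) q).
have [L LK] := row_fullP (col_base_full eigproj).
have [K KK] := row_freeP (row_base_free eigproj).
have eB : symbmx *m col_base eigproj = lam *: col_base eigproj.
  have E : eigproj *m K = col_base eigproj.
    transitivity (col_base eigproj *m row_base eigproj *m K).
      by rewrite mulmx_base.
    by rewrite -mulmxA KK mulmx1.
  by rewrite -E mulmxA symbmx_eigproj scalemxAl.
split.
- by rewrite rank_idempotent ?tr_eigproj ?eigproj_idem.
- move=> q A.
  have /matrixP/(_ (enum_rank A) 0) : symbmx *m col q (col_base eigproj) =
     \col_r symb (fun A => col_base eigproj (enum_rank A) q) (enum_val r).
    apply: symbmx_mul; apply/matrixP => r s.
    by rewrite !mxE enum_valK.
  by rewrite col_mulmx eB !mxE enum_rankK.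
- move=> cs cs0 q.
  have : col_base eigproj *m (\col_q cs q) = 0.
    apply/matrixP => r s; rewrite !mxE -[RHS](cs0 (enum_val r)) enum_valK.
    by apply: eq_bigr => t _; rewrite [X in _ * X]mxE mulrC.
  move=> /(congr1 (mulmx L)); rewrite mulmxA LK mul1mx mulmx0 => /matrixP/(_ q 0).
  by rewrite !mxE.
move=> a ea; pose v : 'cV[F]_N := \col_r a (enum_val r).
have ev : eigproj *m v = v.
  apply: eigproj_fix; rewrite symb_mx; apply/matrixP => r s.
  by rewrite !mxE ea.
exists (fun q => (row_base eigproj *m v) q 0) => A.
have /matrixP/(_ (enum_rank A) 0) := ev.
rewrite [X in _ = X -> _]mxE enum_rankK => <-.
rewrite -{1}(mulmx_base eigproj) -mulmxA mxE.
by apply: eq_bigr => q _; rewrite mulrC.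
Qed.

End Star.
End LinAlg.

(** * Dictionary between increasing lists and finite sets *)

Module Bridge.
Import all_boot all_algebra complex Rstruct ring zify.
Import FourierLine FourierTorus Eigenforms LinAlg Defs.
Import GRing.Theory Num.Theory.
Set Implicit Arguments. Unset Strict Implicit. Unset Printing Implicit Defensive.
Local Open Scope ring_scope.

Definition set_list n (A : {set 'I_n}) : list nat := [seq val i | i <- enum A].
Definition list_set n (I : list nat) : {set 'I_n} := [set i | val i \in I].

Lemma mem_set_list n (A : {set 'I_n}) (i : 'I_n) : (val i \in set_list A) = (i \in A).
Proof. by rewrite /set_list (mem_map val_inj) mem_enum. Qed.

Lemma set_list_lt n (A : {set 'I_n}) x : x \in set_list A -> (x < n)%N.
Proof. by case/mapP => i _ ->; exact: ltn_ord. Qed.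

Lemma sorted_set_list n (A : {set 'I_n}) : sorted ltn (set_list A).
Proof.
apply: (@subseq_sorted _ ltn ltn_trans _ (iota 0 n)); last exact: iota_ltn_sorted.
rewrite -val_enum_ord /set_list; apply: map_subseq.
by rewrite [enum (ordinal n)]enumT; exact: filter_subseq.
Qed.

Lemma sorted_ltn_eq (s t : list nat) : sorted ltn s -> sorted ltn t -> s =i t -> s = t.
Proof. exact: (irr_sorted_eq ltn_trans ltnn). Qed.

(** A strictly increasing list is determined by its members, so identities between multi-indices
    reduce to membership. *)
Lemma set_listP n (A : {set 'I_n}) (s : list nat) : sorted ltn s ->
  (forall x, x \in s -> (x < n)%N) -> (forall i : 'I_n, (val i \in s) = (i \in A)) ->
  s = set_list A.
Proof.
move=> ss sn sA; apply: sorted_ltn_eq => //; first exact: sorted_set_list.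
move=> x; apply/idP/idP => xs.
  by have := xs; rewrite -[x]/(val (Ordinal (sn _ xs))) sA mem_set_list.
by have := xs; rewrite -[x]/(val (Ordinal (set_list_lt xs))) sA mem_set_list.
Qed.

Lemma list_setK n (A : {set 'I_n}) : list_set n (set_list A) = A.
Proof. by apply/setP => i; rewrite inE mem_set_list. Qed.

Lemma size_set_list n (A : {set 'I_n}) : size (set_list A) = #|A|.
Proof. by rewrite size_map -cardE. Qed.

Lemma Sorted_sorted s : Sorted lt s <-> sorted ltn s.
Proof.
elim: s => [|x s IH]; first by split => // _; constructor.
split=> [H|].
  have [/IH ss Hx] : Sorted lt s /\ HdRel lt x s by inversion H.
  case: s ss Hx {IH H} => //= y s ss Hx; rewrite ss andbT.
  by inversion Hx; apply/ltP.
move=> /= xs; constructor; first by apply/IH; exact: path_sorted xs.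
by case: s xs {IH} => [|y s] /=; constructor; case/andP: xs => /ltP.
Qed.

Lemma Forall_all s n : List.Forall (fun i => (i < n)%coq_nat) s <-> (forall x, x \in s -> (x < n)%N).
Proof.
elim: s => [|y s IH]; first by split.
split=> [H x|H].
  have [Hy /IH Hs] : (y < n)%coq_nat /\ List.Forall (fun i => (i < n)%coq_nat) s by inversion H.
  by rewrite inE => /orP[/eqP->|/Hs//]; apply/ltP.
constructor; first by apply/ltP; apply: H; rewrite inE eqxx.
by apply/IH => x xs; apply: H; rewrite inE xs orbT.
Qed.

Lemma valid_set_list n k (A : {set 'I_n}) : #|A| = k -> valid_idx n k (set_list A).
Proof.
move=> cA; split; first exact: (etrans (size_set_list A)).
split; first by apply/Sorted_sorted; exact: sorted_set_list.
by apply/Forall_all => x; exact: set_list_lt.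
Qed.

Lemma valid_idxP n k I : valid_idx n k I -> I = set_list (list_set n I) /\ #|list_set n I| = k.
Proof.
case=> sI [/Sorted_sorted ss /Forall_all In].
have E : I = set_list (list_set n I) by apply: set_listP => // i; rewrite inE.
by split=> //; rewrite -size_set_list -E.
Qed.

Lemma eqbE (x y : nat) : Nat.eqb x y = (x == y).
Proof. by apply/idP/eqP => /PeanoNat.Nat.eqb_eq. Qed.

Lemma ltbE (x y : nat) : Nat.ltb x y = (x < y)%N.
Proof. by apply/idP/idP => [/PeanoNat.Nat.ltb_lt/ltP|/ltP/PeanoNat.Nat.ltb_lt]. Qed.

Lemma existsbE (x : nat) (s : seq nat) : List.existsb (Nat.eqb x) s = (x \in s).
Proof. by elim: s => //= y s ->; rewrite inE eqbE. Qed.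

Lemma list_filterE T (p : T -> bool) s : List.filter p s = [seq x <- s | p x].
Proof. by []. Qed.

Lemma list_seqE a m : List.seq a m = iota a m.
Proof. by elim: m a => //= m IH a; rewrite IH. Qed.

Lemma compl_set_list n (A : {set 'I_n}) : compl n (set_list A) = set_list (~: A).
Proof.
apply: set_listP.
- rewrite /compl list_filterE list_seqE; apply: sorted_filter; [exact: ltn_trans|].
  exact: iota_ltn_sorted.
- by move=> x; rewrite /compl list_filterE list_seqE mem_filter mem_iota => /andP[_ /andP[]].
move=> i; rewrite /compl list_filterE list_seqE mem_filter mem_iota existsbE mem_set_list inE.
by rewrite leq0n add0n ltn_ord !andbT.
Qed.

Lemma big_set_list (V : nmodType) n (A : {set 'I_n}) (G : nat -> V) :
  \sum_(x <- set_list A) G x = \sum_(i in A) G (val i).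
Proof. by rewrite big_map big_enum. Qed.

Lemma count_below n (A : {set 'I_n}) (j : 'I_n) :
  count (fun c => c < val j)%N (set_list A) = below A j.
Proof.
rewrite /below -sum1_count big_mkcond big_map big_enum /=.
by apply: eq_bigr => i _; case: ifP.
Qed.

Lemma ninvE n (A B : {set 'I_n}) : ninv (set_list A) (set_list B) = inversions A B.
Proof.
rewrite /inversions.
transitivity (\sum_(a <- set_list A) count (fun c => c < a)%N (set_list B))%N.
  rewrite /ninv; elim: (set_list A) => [|a s IH]; first by rewrite big_nil.
  rewrite big_cons -IH /= plusE; congr (_ + _)%N.
  rewrite list_filterE -size_filter; congr size; apply: eq_filter => c.
  exact: ltbE.
rewrite big_map big_enum /=; apply: eq_bigr => a _; exact: count_below.
Qed.

(** Turns the position of an entry, used by the sign of the exterior derivative on lists, into the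
    count used by [wsign]. *)
Lemma index_sorted s j : sorted ltn s -> j \in s -> index j s = count (fun c => c < j)%N s.
Proof.
elim: s => //= x s IH xs; rewrite inE; case: eqVneq => [->|jx] /= js.
  rewrite ltnn add0n; apply/esym/eqP; rewrite -leqn0 leqNgt -has_count.
  apply/hasPn => y ys; rewrite -leqNgt.
  by have /allP/(_ y ys)/ltnW := order_path_min ltn_trans xs.
rewrite IH ?(path_sorted xs) //.
by have /allP/(_ j js) /= -> := order_path_min ltn_trans xs.
Qed.

Lemma remove_nth_index s (j : nat) : uniq s -> j \in s ->
  remove_nth (index j s) s = [seq x <- s | x != j].
Proof.
elim: s => //= x s IH /andP[xs us]; rewrite inE eq_sym.
case: (eqVneq x j) => [xj _|jx /= js] /=; last by rewrite IH.
rewrite xj in xs.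
apply/esym/all_filterP/allP => y ys; by apply: contraNneq xs => <-.
Qed.

Lemma uniq_set_list n (A : {set 'I_n}) : uniq (set_list A).
Proof. by rewrite map_inj_uniq ?enum_uniq //; exact: val_inj. Qed.

Lemma remove_nth_set_list n (A : {set 'I_n}) (j : 'I_n) : j \in A ->
  remove_nth (index (val j) (set_list A)) (set_list A) = set_list (A :\ j).
Proof.
move=> jA; rewrite remove_nth_index ?uniq_set_list ?mem_set_list //.
apply: set_listP.
- by apply: sorted_filter; [exact: ltn_trans|exact: sorted_set_list].
- by move=> x; rewrite mem_filter => /andP[_]; exact: set_list_lt.
by move=> i; rewrite mem_filter mem_set_list !inE.
Qed.

Lemma list_nthE s i : List.nth i s O = nth O s i.
Proof. by elim: s i => [|x s IH] [|i] //=. Qed.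

(** * Transfer of the symbol to complex matrices, and its eigenbasis on lists *)

Definition toF (z : Cx) : R[i] := Complex (fst z) (snd z).
Definition ofF (w : R[i]) : Cx := (complex.Re w, complex.Im w).

Lemma toFK z : ofF (toF z) = z. Proof. by case: z. Qed.
Lemma ofFK w : toF (ofF w) = w. Proof. by case: w. Qed.
Lemma toF_inj z w : toF z = toF w -> z = w.
Proof. by move=> e; rewrite -(toFK z) e toFK. Qed.
Lemma toF0 : toF c0 = 0. Proof. by []. Qed.
Lemma toFM z w : toF (cmul z w) = toF z * toF w. Proof. by []. Qed.
Lemma toF_real (r : R) : toF (r, IZR 0) = r%:C%C. Proof. by []. Qed.
Lemma real_complexM (x y : R) : (Rmult x y)%:C%C = x%:C%C * y%:C%C.
Proof. exact: (rmorphM (real_complex _) x y). Qed.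
Lemma toFZ (r : R) z : toF (cscal r z) = r%:C%C * toF z.
Proof. by rewrite cscalE toFM. Qed.

Lemma toF_csum T (l : list T) f : toF (csum l f) = \sum_(x <- l) toF (f x).
Proof.
rewrite /csum; elim: l => [|x l IH]; first by rewrite big_nil.
by rewrite big_cons -IH.
Qed.

Lemma toF_sgn m : toF (sgn m, IZR 0) = (-1) ^+ m.
Proof.
rewrite /sgn -signr_odd.
have -> : Nat.even m = ~~ odd m.
  by elim: m => // m IH; rewrite PeanoNat.Nat.even_succ -PeanoNat.Nat.negb_even IH.
by case: (odd m) => /=; rewrite ?expr0 ?expr1 //; apply/eqP; rewrite eq_complex /= oppr0 !eqxx.
Qed.

Lemma sum_positions (V : nmodType) (s : list nat) (G : nat -> V) : uniq s ->
  \sum_(a <- List.seq 0 (length s)) G a = \sum_(x <- s) G (index x s).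
Proof.
move=> us; rewrite list_seqE [RHS](big_nth O) -[length s]/(size s).
rewrite -{1}[size s]subn0 -/(index_iota _ _).
by apply: eq_big_nat => i /andP[_ i_s]; rewrite index_uniq.
Qed.

(** The sum over positions in the complementary list becomes a sum over elements of the complement;
    the position of j becomes [below (~: A) j], so the alternating sign is exactly that of
    [wedge]. *)
Lemma toF_symbol n (mu : Pt) a (A : {set 'I_n}) :
  toF (symbol n mu a (set_list A)) =
  toF (symb_const n) * star (wedge (fun i => (mu i)%:C%C) (fun B => toF (a (set_list B)))) A.
Proof.
rewrite /symbol curl_at_csum toF_csum compl_set_list sum_positions ?uniq_set_list //.
rewrite big_set_list /star /wedge !mulr_sumr; apply: eq_bigr => j jA.
rewrite /curl_weight compl_set_list ninvE !toFM !toF_sgn list_nthE nth_index ?mem_set_list //.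
rewrite remove_nth_set_list // index_sorted ?sorted_set_list ?mem_set_list // count_below.
rewrite partial_symbol toFM toF_real.
rewrite /starsign /wsign /symb_const; ring.
Qed.

Lemma rsumE n f : rsum n f = \sum_(i < n) f (val i).
Proof. by elim: n => [|n IH]; rewrite ?big_ord0 // big_ord_recr /= -IH. Qed.

Lemma INRE_nat m : INR m = m%:R.
Proof. by elim: m => // m IH; rewrite S_INR IH -natr1. Qed.

Section Odd.
Variables (n k : nat).
Hypotheses (hn : n = k.*2.+1) (k_gt0 : (0 < k)%N).

Lemma half_dim : Nat.div (n - 1)%coq_nat 2 = k.
Proof.
have -> : (n - 1)%coq_nat = (k * 2)%coq_nat by rewrite hn; lia.
by rewrite PeanoNat.Nat.div_mul.
Qed.

Lemma faces_valid_odd : faces_valid n.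
Proof.
rewrite /faces_valid half_dim => I vI a; have [-> cA] := valid_idxP vI.
rewrite compl_set_list => la.
set J := ~: list_set n I in la *.
have aJ : (a < size (set_list J))%N by apply/ltP.
have := mem_nth O aJ; set x := nth _ _ _ => xJ.
have xn := set_list_lt xJ; pose j := Ordinal xn.
have jJ : j \in J by rewrite -mem_set_list.
have ax : a = index (val j) (set_list J) by rewrite index_uniq ?uniq_set_list.
split; first by rewrite list_nthE; apply/ltP.
rewrite ax remove_nth_set_list //; apply: valid_set_list.
by rewrite list_setK in cA; exact: (card_setCD1 hn).
Qed.

Variable (mu : Pt).
Let muF (i : 'I_n) : R[i] := (mu i)%:C%C.
Let c : R[i] := toF (symb_const n).

Lemma mod4_odd : Nat.eqb (Nat.modulo n 4) 1 = ~~ odd k.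
Proof.
have -> : n = ((if odd k then 3 else 1) + k./2 * 4)%coq_nat.
  by rewrite hn -{1}[k]odd_double_half; case: (odd k) => /=; lia.
by rewrite PeanoNat.Nat.Div0.mod_add; case: (odd k).
Qed.

(** As n = 2k + 1, the residue of n mod 4 is 1 exactly when k is even. So the sign of the squared
    constant is (-1)^k and the product is positive in both cases. *)
Lemma toF_symb_const_sq : c ^+ 2 * (-1) ^+ k = (Rmult (Rmult 2 PI) (Rmult 2 PI))%:C%C.
Proof.
rewrite expr2 /c -toFM symb_const_sq toFM toF_real mod4_odd -[in LHS]signr_odd.
rewrite mulrAC; case: (odd k) => /=; rewrite ?expr0 ?expr1 toF_real.
  have -> : (IZR (-1))%:C%C = -1 :> R[i].
    by apply/eqP; rewrite eq_complex /= oppr0 !eqxx.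
  by rewrite mulrNN !mul1r.
have -> : (IZR 1)%:C%C = 1 :> R[i] by apply/eqP; rewrite eq_complex /= !eqxx.
by rewrite mulr1 mul1r.
Qed.

Definition symbF (a : {set 'I_n} -> R[i]) := symb k muF c a.

Lemma toF_symbolE a (A : {set 'I_n}) : #|A| = k ->
  toF (symbol n mu a (set_list A)) = symbF (fun B => toF (a (set_list B))) A.
Proof. by move=> cA; rewrite toF_symbol /symbF /symb cA eqxx. Qed.

Lemma hlamF (lam : R) : Rabs lam = Rmult (Rmult 2 PI) (vnorm n mu) ->
  c ^+ 2 * (-1) ^+ k * \sum_j muF j ^+ 2 = (lam%:C%C) ^+ 2.
Proof.
move=> /sphere_sq hl; rewrite toF_symb_const_sq expr2 -rmorphM /= -[_ * lam]/(Rmult lam lam) hl.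
rewrite [in RHS]real_complexM rsumE (rmorph_sum (real_complex R)); congr (_ * _).
by apply: eq_bigr => i _; rewrite expr2 -rmorphM.
Qed.

Lemma symbol_eig_symb (lam : R) a : symbol_eig n mu lam a ->
  forall A : {set 'I_n}, symbF (fun B => toF (a (set_list B))) A =
    lam%:C%C * toF (a (set_list A)).
Proof.
rewrite /symbol_eig half_dim => -[a0 ae] A; case: (eqVneq #|A| k) => cA.
  by rewrite -toF_symbolE // ae ?toFZ //; exact: valid_set_list.
rewrite a0 => [|/valid_idxP[_]]; last by rewrite list_setK; apply/eqP.
by rewrite /symbF /symb (negbTE cA) mulr0.
Qed.

Lemma symbF_Z (x : R[i]) a A : symbF (fun B => x * a B) A = x * symbF a A.
Proof.
rewrite /symbF /symb; case: ifP => _; last by rewrite mulr0.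
by rewrite /star wedgeZ; ring.
Qed.

(** The cube identity is used with r0 = 2 pi |mu| in place of lam. On an eigenvector it reads lam^3
    a = r0^2 lam a, and dividing by lam and by a nonzero component leaves lam^2 = r0^2. *)
Lemma symbol_eig_norm (lam : R) a I : lam <> IZR 0 -> symbol_eig n mu lam a -> a I <> c0 ->
  Rabs lam = Rmult (Rmult 2 PI) (vnorm n mu).
Proof.
move=> lam0 ea aI.
have vI : valid_idx n k I.
  by apply: NNPP => nv; apply: aI; apply: (proj1 ea); rewrite half_dim.
have [eI cA] := valid_idxP vI.
set r0 := Rmult (Rmult 2 PI) (vnorm n mu).
have r0_ge0 : Rle (IZR 0) r0.
  apply: Rmult_le_pos; last exact: sqrt_pos.
  by apply: Rmult_le_pos; [apply: IZR_le|apply: Rlt_le PI_RGT_0].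
have h0 := hlamF (Rabs_pos_eq _ r0_ge0).
have es := symbol_eig_symb ea.
set al := (fun B => toF (a (set_list B))) in es.
have e1 : symbF al = fun A => lam%:C%C * al A by apply: functional_extensionality.
have := symb_cube hn h0 al (list_set n I).
rewrite -/(symbF al) -/(symbF (symbF al)) -/(symbF (symbF (symbF al))).
rewrite e1.
have e2 : symbF (fun A => lam%:C%C * al A) = fun A => lam%:C%C * (lam%:C%C * al A).
  by apply: functional_extensionality => A; rewrite symbF_Z es.
rewrite e2 symbF_Z symbF_Z es => E.
have al0 : al (list_set n I) != 0.
  rewrite /al -eI; apply/eqP => z; apply: aI; apply: toF_inj; by rewrite z.
have lamC0 : lam%:C%C != 0 :> R[i].
  by apply/eqP => -[z]; apply: lam0.
have : lam%:C%C * lam%:C%C = r0%:C%C * r0%:C%C.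
  apply: (mulIf lamC0); apply: (mulIf al0).
  by move: E; rewrite expr2 !mulrA.
rewrite -!real_complexM => -[] E2; apply/sphere_sq.
by rewrite E2; apply/sphere_sq; exact: Rabs_pos_eq.
Qed.

End Odd.

Lemma toF_lincombv cs vs I : length cs = length vs ->
  toF (lincombv cs vs I) =
  \sum_(q < length vs) toF (nth c0 cs q) * toF (nth (fun=> c0) vs q I).
Proof.
elim: cs vs => [|x cs IH] [|v vs] //=; first by rewrite big_ord0.
by case=> e; rewrite big_ord_recl /= -IH.
Qed.

Lemma Forall_nth0 (s : list Cx) :
  (forall q, (q < size s)%N -> nth c0 s q = c0) -> List.Forall (fun z => z = c0) s.
Proof.
elim: s => [|x s IH] H; constructor; first exact: (H 0%N).
by apply: IH => q qs; exact: (H q.+1).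
Qed.

Lemma binomial_real m j : (j <= m)%N -> Binomial.C m j = ('C(m, j))%:R :> R.
Proof.
move=> jm; have factE : forall p, fact p = p`! by elim=> //= p ->; rewrite factS; lia.
have f0 : forall p, INR p`! <> IZR 0.
  by move=> p; apply: not_0_INR => z; have := fact_gt0 p; rewrite z.
rewrite -INRE_nat /Binomial.C !factE -(bin_fact jm) -!multE !mult_INR.
rewrite minusE /Rdiv Rmult_assoc Rinv_r ?Rmult_1_r //.
by apply: Rmult_integral_contrapositive_currified; exact: f0.
Qed.

Lemma symbol_eigenbasis n k (hn : n = k.*2.+1) (k_gt0 : (0 < k)%N) (mu : Pt) (lam : R) :
  lam <> IZR 0 -> Rabs lam = Rmult (Rmult 2 PI) (vnorm n mu) ->
  exists (D : nat) vs, INR D = Rmult (Rinv 2) (Binomial.C (2 * k)%N k) /\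
    length vs = D /\ vbasis (symbol_eig n mu lam) vs.
Proof.
move=> lam0 hl.
have lamC0 : lam%:C%C != 0 :> R[i] by apply/eqP => -[z]; apply: lam0.
have [D [u [hD ue uind uspan]]] := symb_eigenbasis hn k_gt0 lamC0 (hlamF hn k_gt0 hl).
(* The test says that I is the increasing enumeration of a k-subset; on all other lists the value
   must be 0, as [symbol_eig] demands. *)
pose v (q : 'I_D) (I : list nat) : Cx :=
  if (set_list (list_set n I) == I) && (#|list_set n I| == k)
  then ofF (u q (list_set n I)) else c0.
have vA q (A : {set 'I_n}) : toF (v q (set_list A)) = u q A.
  rewrite /v list_setK eqxx /=; case: eqP => [_|/eqP nA]; first exact: ofFK.
  (* Off the k-subsets the symbol is 0, so the eigenvector equation with lam nonzero forces the
     component to be 0 as well. *)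
  have := ue q A; rewrite /symb (negbTE nA) => /esym/eqP.
  by rewrite mulf_eq0 (negbTE lamC0) /= => /eqP ->.
have v0 q I : ~ valid_idx n k I -> v q I = c0.
  move=> nv; rewrite /v; case: ifP => // /andP[/eqP e /eqP cA].
  by case: nv; rewrite -e; exact: valid_set_list.
pose vs := [seq v q | q <- enum 'I_D].
have svs : length vs = D by rewrite -[length vs]/(size vs) size_map size_enum_ord.
have nvs (q : 'I_D) : nth (fun=> c0) vs q = v q.
  by rewrite (nth_map q) ?size_enum_ord // nth_ord_enum.
have lcA cs (A : {set 'I_n}) : length cs = D -> toF (lincombv cs vs (set_list A)) =
    \sum_(q < D) toF (nth c0 cs q) * u q A.
  move=> lcs; rewrite toF_lincombv ?lcs ?svs //.
  by apply: eq_bigr => q _; rewrite nvs vA.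
have lc0 cs I : length cs = D -> ~ valid_idx n k I -> lincombv cs vs I = c0.
  move=> lcs nv; apply: toF_inj; rewrite toF_lincombv ?lcs ?svs // big1 // => q _.
  by rewrite nvs v0 // mulr0.
exists D, vs; split; [|split=> //; split; [|split]].
- move: hD; rewrite [in n.-1]hn /= -muln2 mulnC => hD.
  rewrite binomial_real; last by rewrite leq_pmull.
  rewrite INRE_nat; apply: (@complexI R).
  rewrite real_complexM rmorph_nat hD; congr (_ * _); last by rewrite rmorph_nat.
  apply/esym; rewrite -[2 in RHS](@rmorph_nat _ _ (real_complex R)) -fmorphV; congr (_%:C%C).
- rewrite /vs; elim: (enum 'I_D) => [|q s IH]; constructor => //.
  rewrite /symbol_eig (half_dim hn k_gt0); split=> [I|I vI]; first exact: v0.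
  have [eI cA] := valid_idxP vI; rewrite eI; apply: toF_inj.
  rewrite (toF_symbolE _ _ cA) toFZ vA -ue /symbF; congr (symb _ _ _ _ _).
  by apply: functional_extensionality => A; rewrite vA.
- move=> cs; rewrite svs => lcs c_0; apply: Forall_nth0 => q qs.
  have qD : (q < D)%N by rewrite -lcs.
  apply: toF_inj; rewrite toF0 -[q]/(val (Ordinal qD)).
  apply: (uind (fun q => toF (nth c0 cs q))) => A.
  by rewrite -lcA // c_0.
move=> a ea; have [x hx] := uspan _ (symbol_eig_symb hn k_gt0 ea).
exists [seq ofF (x q) | q <- enum 'I_D].
have lcs : length [seq ofF (x q) | q <- enum 'I_D] = D.
  by rewrite -[length _]/(size _) size_map size_enum_ord.
split; first by rewrite lcs svs.
move=> I; case: (classic (valid_idx n k I)) => vI.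
  have [-> cA] := valid_idxP vI; apply: toF_inj; rewrite lcA // hx.
  by apply: eq_bigr => q _; rewrite (nth_map q) ?size_enum_ord // nth_ord_enum ofFK.
by rewrite lc0 //; apply: (proj1 ea); rewrite (half_dim hn k_gt0).
Qed.

(** The matrix B with rows b_j has trivial left kernel by independence, and bs_i is the i-th column
    of its inverse. The two clauses come from B B^-1 = 1 and B^-1 B = 1. *)
Lemma dual_basis_exists n b : (0 < n)%N -> basis_indep n b -> exists bs, dual_basis n b bs.
Proof.
case: n => // n _ hb.
pose B : 'M[R]_n.+1 := \matrix_(j, i) b (val j) (val i).
have Bu : B \in unitmx.
  rewrite -row_free_unit -kermx_eq0; apply/eqP/row_matrixP => r; rewrite row0.
  set c := row r (kermx B).
  have cB : c *m B = 0 by apply/sub_kermxP; exact: row_sub.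
  apply/rowP => j; rewrite [RHS]mxE.
  have E (i : 'I_n.+1) : c 0 i = c 0 (inord (val i)) by rewrite inord_val.
  rewrite E; apply: (hb (fun j => c 0 (inord j))); last by apply/ltP; exact: ltn_ord.
  move=> i /ltP ni; rewrite rsumE.
  have /rowP/(_ (Ordinal ni)) := cB; rewrite mxE [RHS]mxE => H.
  apply: etrans H; apply: eq_bigr => l _; rewrite -E [B _ _]mxE //.
exists (fun i l => invmx B (inord l) (inord i)); split.
  move=> i j /ltP iN /ltP jN; rewrite /dot rsumE eqbE.
  have /matrixP/(_ (Ordinal jN) (Ordinal iN)) := mulmxV Bu; rewrite !mxE.
  rewrite -val_eqE /= eq_sym => E.
  transitivity (((i == j)%:R) : R); last by case: (i == j).
  rewrite -E; apply: eq_bigr => l _.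
  have -> : inord i = Ordinal iN by apply: val_inj; rewrite /= inordK.
  by rewrite [B _ _]mxE /= inord_val; exact: Rmult_comm.
move=> x i /ltP iN; rewrite rsumE.
transitivity (\sum_(j < n.+1) \sum_(l < n.+1) x (val l) * (invmx B l j * B j (Ordinal iN))).
  rewrite exchange_big /=.
  under eq_bigr => l _ do rewrite -mulr_sumr.
  have E l : \sum_(j < n.+1) invmx B l j * B j (Ordinal iN) = (l == Ordinal iN)%:R.
    by have /matrixP/(_ l (Ordinal iN)) := mulVmx Bu; rewrite !mxE.
  rewrite (bigD1 (Ordinal iN)) //= E eqxx mulr1 big1 ?addr0 // => l nl.
  by rewrite E (negbTE nl) mulr0.
apply: eq_bigr => j _.
transitivity ((\sum_(l < n.+1) invmx B l j * x (val l)) * B j (Ordinal iN)).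
  by rewrite mulr_suml; apply: eq_bigr => l _; rewrite mulrCA mulrA.
rewrite [B _ _]mxE /dot rsumE; congr (Rmult _ _).
by apply: eq_bigr => l _; rewrite !inord_val.
Qed.

Lemma odd_dim n : (3 <= n)%coq_nat -> Nat.odd n = true ->
  exists k, [/\ n = k.*2.+1, (0 < k)%N, Nat.div (n - 1)%coq_nat 2 = k & (2 * k)%N = (n - 1)%coq_nat].
Proof.
move=> n3 no; exists n./2.
have nodd : odd n.
  rewrite -(negbK (odd n)); move: no; rewrite -PeanoNat.Nat.negb_even.
  by have -> : Nat.even n = ~~ odd n
    by elim: (n) => // m IH; rewrite PeanoNat.Nat.even_succ -PeanoNat.Nat.negb_even IH.
have hn : n = (n./2).*2.+1 by rewrite -{1}(odd_double_half n) nodd.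
have k0 : (0 < n./2)%N by lia.
by split=> //; [exact: (half_dim hn k0) | lia].
Qed.


End Bridge.

Theorem mainTheorem15 (n : nat) (b : nat -> Pt) :
  (3 <= n)%nat -> Nat.odd n = true -> basis_indep n b ->
  forall lam : R, lam <> 0 ->
  (is_eigenvalue n b lam <->
     exists mu, dual_mem n b mu /\ Rabs lam = 2 * PI * vnorm n mu) /\
  (is_eigenvalue n b lam ->
     exists N d : nat,
       card_vecs n (fun mu => dual_mem n b mu /\ vnorm n mu = Rabs lam / (2 * PI)) N /\
       cdim (eigensp n b lam) d /\
       INR d = / 2 * C (n - 1) ((n - 1) / 2) * INR N).
Proof.
  intros n3 no hb lam lam0.
  destruct (@Bridge.odd_dim n n3 no) as [k [hn k0 hk h2k]].
  assert (n0 : is_true (ssrnat.leq 1 n)) by (rewrite hn; reflexivity).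
  destruct (@Bridge.dual_basis_exists n b n0 hb) as [bs Hb].
  assert (Hf := @Bridge.faces_valid_odd n k hn k0).
  assert (HB := @Bridge.symbol_eigenbasis n k hn k0); rewrite h2k, <- hk in HB.
  assert (HN : forall m a I, Eigenforms.symbol_eig n (FourierTorus.freq n bs m) lam a -> a I <> c0 ->
    Rabs lam = 2 * PI * vnorm n (FourierTorus.freq n bs m)).
  { intros m a I; exact (@Bridge.symbol_eig_norm n k hn k0 _ lam a I lam0). }
  assert (HP := PI_RGT_0).
  assert (HR : forall v, Rabs lam = 2 * PI * v <-> v = Rabs lam / (2 * PI)).
  { intros v; split; intros H; [rewrite H|rewrite H]; field; lra. }
  split; [split|].
  - intros He; destruct (Eigenforms.eigenvalue_mode n b bs lam Hb Hf He) as [m [a [I [Ha HI]]]].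
    exists (FourierTorus.freq n bs m); split; [now apply FourierTorus.dual_freq|now apply (HN m a I)].
  - intros [mu [Hmu Hr]].
    destruct (HB mu lam lam0 Hr) as [D [vs [HD [Hl Hv]]]].
    destruct (Eigenforms.vbasis_nonzero _ _ Hv) as [a [I [Ha HI]]].
    + rewrite Hl; apply INR_lt; rewrite HD; apply Rmult_lt_0_compat; [lra|].
      apply Rdiv_lt_0_compat; [|apply Rmult_lt_0_compat]; apply INR_fact_lt_0.
    + exists (Eigenforms.mode_form n mu a); split.
      * now apply Eigenforms.mode_form_eigen.
      * exists I, (fun _ => 0); unfold Eigenforms.mode_form; now rewrite FourierTorus.mode_0.
  - intros He.
    (* One frequency on the sphere is enough to fix the block size D. *)
    destruct (Eigenforms.eigenvalue_mode n b bs lam Hb Hf He) as [m0 [a0 [I0 [Ha0 HI0]]]].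
    destruct (HB _ lam lam0 (HN _ _ _ Ha0 HI0)) as [D [_ [HD _]]].
    destruct (Eigenforms.sphere_frequencies n b bs (Rabs lam / (2 * PI)) Hb) as [ms [Hd [HF HC]]].
    exists (length ms), (length ms * D)%nat; repeat split.
    + now apply (Eigenforms.card_frequencies n b bs).
    + apply (Eigenforms.eigensp_cdim n b bs); try assumption.
      * intros m Hm; rewrite List.Forall_forall in HF.
        destruct (HB (FourierTorus.freq n bs m) lam lam0) as [D' [vs [HD' [Hl Hv]]]].
        { now apply HR, HF. }
        exists vs; split; [|exact Hv]; rewrite Hl; apply INR_eq; congruence.
      * intros m a I Ha HI; apply HC, HR; now apply (HN m a I).
    + rewrite mult_INR, HD; ring.
Qed.
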